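(* Suppose that $Q_k\ge 0$ and $Q_k+\bar Q_k\ge 0$ for all $k\in\{0,1,\dots,N\}$, and $R_k>0$ and $R_k+\bar R_k>0$ for all $k\in\{0,1,\dots,N-1\}$. Introduce the Riccati equations: for $k=N-1,\dots,0$, $$\begin{aligned} S^x_k&=Q_k+A_k^TS^x_{k+1}A_k+C_k^TS^x_{k+1}C_k-H^{(1)}_k(W^{(1)}_k)^{-1}(H^{(1)}_k)^T,\\ T^x_k&=Q_k+\bar Q_k+(A_k+\bar A_k)^TT^x_{k+1}(A_k+\bar A_k)+(C_k+\bar C_k)^TS^x_{k+1}(C_k+\bar C_k)-H^{(2)}_k(W^{(2)}_k)^{-1}(H^{(2)}_k)^T,\\ S^{xy}_k&=-Q_k+F_k^TS^{xy}_{k+1}A_k+\rho\,G_k^TS^{xy}_{k+1}C_k-H^{(3)}_k(W^{(1)}_k)^{-1}(H^{(1)}_k)^T,\\ T^{xy}_k&=-Q_k-\bar Q_k+(F_k+\bar F_k)^TT^{xy}_{k+1}(A_k+\bar A_k)+\rho\,(G_k+\bar G_k)^TS^{xy}_{k+1}(C_k+\bar C_k)-H^{(4)}_k(W^{(2)}_k)^{-1}(H^{(2)}_k)^T,\\ S^y_k&=Q_k+F_k^TS^y_{k+1}F_k+G_k^TS^y_{k+1}G_k-H^{(3)}_k(W^{(1)}_k)^{-1}(H^{(3)}_k)^T,\\ T^y_k&=Q_k+\bar Q_k+(F_k+\bar F_k)^TT^y_{k+1}(F_k+\bar F_k)+(G_k+\bar G_k)^TS^y_{k+1}(G_k+\bar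 G_k)-H^{(4)}_k(W^{(2)}_k)^{-1}(H^{(4)}_k)^T, \end{aligned}$$ with terminal values $S^x_N=Q_N$, $T^x_N=Q_N+\bar Q_N$, $S^{xy}_N=-Q_N$, $T^{xy}_N=-Q_N-\bar Q_N$, $S^y_N=Q_N$, $T^y_N=Q_N+\bar Q_N$, where $$\begin{aligned} W^{(1)}_k&=R_k+B_k^TS^x_{k+1}B_k+D_k^TS^x_{k+1}D_k,\\ W^{(2)}_k&=R_k+\bar R_k+(B_k+\bar B_k)^TT^x_{k+1}(B_k+\bar B_k)+(D_k+\bar D_k)^TS^x_{k+1}(D_k+\bar D_k),\\ H^{(1)}_k&=A_k^TS^x_{k+1}B_k+C_k^TS^x_{k+1}D_k,\\ H^{(2)}_k&=(A_k+\bar A_k)^TT^x_{k+1}(B_k+\bar B_k)+(C_k+\bar C_k)^TS^x_{k+1}(D_k+\bar D_k),\\ H^{(3)}_k&=F_k^TS^{xy}_{k+1}B_k+\rho\,G_k^TS^{xy}_{k+1}D_k,\\ H^{(4)}_k&=(F_k+\bar F_k)^TT^{xy}_{k+1}(B_k+\bar B_k)+\rho\,(G_k+\bar G_k)^TS^{xy}_{k+1}(D_k+\bar D_k). \end{aligned}$$ Then for any square-integrable $\zeta^x,\zeta^y$, the unique minimizer of $J(\zeta^x,\zeta^y,u)$ over $u\in\mathcal U_{ad}$ is $$u^*_k=-(W^{(1)}_k)^{-1}(H^{(1)}_k)^T(x_k-\mathbb Ex_k)-(W^{(2)}_k)^{-1}(H^{(2)}_k)^T\mathbb Ex_k-(W^{(1)}_k)^{-1}(H^{(3)}_k)^T(y_k-\mathbb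 Ey_k)-(W^{(2)}_k)^{-1}(H^{(4)}_k)^T\mathbb Ey_k,$$ $k=0,\dots,N-1$.
   Context: $N$ is a positive integer. Given are deterministic matrices $A_k,\bar A_k,C_k,\bar C_k,F_k,\bar F_k,G_k,\bar G_k\in\mathbb R^{n\times n}$ and $B_k,\bar B_k,D_k,\bar D_k\in\mathbb R^{n\times m}$ ($0\le k\le N-1$), deterministic symmetric matrices $Q_k,\bar Q_k\in\mathbb R^{n\times n}$ ($0\le k\le N$) and $R_k,\bar R_k\in\mathbb R^{m\times m}$ ($0\le k\le N-1$), and a constant $\rho\in\mathbb R$. $\mathbb E$ denotes expectation. For symmetric $M$, $M\ge0$ (resp. $M>0$) means positive semidefinite (resp. positive definite). On a probability space $(\Omega,\mathcal F,P)$ let $\zeta^x,\zeta^y$ be square-integrable $\mathbb R^n$-valued random vectors and $(w_k)_{0\le k\le N-1},(v_k)_{0\le k\le N-1}$ real random variables. Let $\mathcal F_k$ be the $\sigma$-algebra generated by $\zeta^x,\zeta^y$ and $w_l,v_l$, $0\le l\le k-1$ (the information available before $w_k,v_k$ are realized), and assume $$\mathbb E[w_k|\mathcal F_k]=\mathbb E[v_k|\mathcal F_k]=0,\quad \mathbb E[w_k^2|\mathcal F_k]=\mathbb E[v_k^2|\mathcal F_k]=1,\quad \mathbb E[w_kv_k|\mathcal F_k]=\rho .$$ The system is, for $k=0,\dots,N-1$, $$x_{k+1}=(A_kx_k+\bar A_k\mathbb Ex_k+B_ku_k+\bar B_k\mathbb Eu_k)+(C_kx_k+\bar C_k\mathbb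 Ex_k+D_ku_k+\bar D_k\mathbb Eu_k)w_k,$$ $$y_{k+1}=(F_ky_k+\bar F_k\mathbb Ey_k)+(G_ky_k+\bar G_k\mathbb Ey_k)v_k,\qquad x_0=\zeta^x,\ y_0=\zeta^y.$$ The cost functional is $$J(\zeta^x,\zeta^y,u)=\sum_{k=0}^{N-1}\mathbb E\Big((x_k-y_k)^TQ_k(x_k-y_k)+u_k^TR_ku_k+(\mathbb E(x_k-y_k))^T\bar Q_k\mathbb E(x_k-y_k)+(\mathbb Eu_k)^T\bar R_k\mathbb Eu_k\Big)$$ $$\qquad+\mathbb E\big((x_N-y_N)^TQ_N(x_N-y_N)\big)+(\mathbb E(x_N-y_N))^T\bar Q_N\mathbb E(x_N-y_N).$$ The admissible set $\mathcal U_{ad}$ consists of all $u=(u_0,\dots,u_{N-1})$ with $u_k$ an $\mathbb R^m$-valued $\mathcal F_k$-measurable random vector and $\mathbb E|u_k|^2<\infty$; controls are identified when almost surely equal. *)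

(* Defs.v *)
From mathcomp Require Export all_boot all_order all_algebra.
From mathcomp Require Export all_classical all_reals all_analysis.

Set Implicit Arguments.
Unset Strict Implicit.
Unset Printing Implicit Defensive.

Import Order.TTheory GRing.Theory Num.Theory.

Local Open Scope classical_set_scope.
Local Open Scope ring_scope.

Definition symmetric_mx (R : realType) (n : nat) (M : 'M[R]_n) : Prop :=
  M^T = M.

Definition quad (R : realType) (n : nat) (M : 'M[R]_n) (x : 'cV[R]_n) : R :=
  (x^T *m M *m x) 0 0.

(* Only used for symmetric M. *)
Definition psd (R : realType) (n : nat) (M : 'M[R]_n) : Prop :=
  forall x : 'cV[R]_n, 0 <= quad M x.

Definition posdef (R : realType) (n : nat) (M : 'M[R]_n) : Prop :=
  forall x : 'cV[R]_n, x != 0 -> 0 < quad M x.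

(* The suffix b stands for the bar.  Sequences are indexed by nat; only the
   entries with k < N (k <= N for Q_ and Qb_) are ever used. *)
Record lq_coeffs (R : realType) (n m : nat) := LQCoeffs {
  A_ : nat -> 'M[R]_n;      Ab_ : nat -> 'M[R]_n;
  B_ : nat -> 'M[R]_(n, m); Bb_ : nat -> 'M[R]_(n, m);
  C_ : nat -> 'M[R]_n;      Cb_ : nat -> 'M[R]_n;
  D_ : nat -> 'M[R]_(n, m); Db_ : nat -> 'M[R]_(n, m);
  F_ : nat -> 'M[R]_n;      Fb_ : nat -> 'M[R]_n;
  G_ : nat -> 'M[R]_n;      Gb_ : nat -> 'M[R]_n;
  Q_ : nat -> 'M[R]_n;      Qb_ : nat -> 'M[R]_n;
  R_ : nat -> 'M[R]_m;      Rb_ : nat -> 'M[R]_m;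
  rho_ : R
}.

Definition sqnorm (R : realType) (n : nat) (x : 'cV[R]_n) : R :=
  \sum_(i < n) x i 0 ^+ 2.

Definition Evec (d : measure_display) (T : measurableType d) (R : realType)
    (P : probability T R) (n : nat) (X : T -> 'cV[R]_n) : 'cV[R]_n :=
  \col_i fine 'E_P[fun t => X t i 0].

(* Measurability of R^n-valued maps is componentwise, which is the Borel one. *)
Definition square_integrable (d : measure_display) (T : measurableType d)
    (R : realType) (P : probability T R) (n : nat) (X : T -> 'cV[R]_n) : Prop :=
  (forall i, measurable_fun [set: T] (fun t => X t i 0)) /\
  ('E_P[fun t => sqnorm (X t)] < +oo)%E.

Definition measurable_wrt (T : Type) (R : realType) (G : set (set T))
    (f : T -> R) : Prop :=
  preimage_set_system [set: T] f (@measurable _ R) `<=` G.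

(* Y is a version of E[X | G]. *)
Definition cond_expectation (d : measure_display) (T : measurableType d)
    (R : realType) (P : probability T R) (G : set (set T)) (X Y : T -> R) :
    Prop :=
  [/\ P.-integrable [set: T] (EFin \o X),
      P.-integrable [set: T] (EFin \o Y),
      measurable_wrt G Y &
      forall S, G S -> (\int[P]_(t in S) (X t)%:E = \int[P]_(t in S) (Y t)%:E)%E].

(* The sigma-algebra generated by zx, zy and w_l, v_l for l < k. *)
Definition info (T : Type) (R : realType) (n : nat) (zx zy : T -> 'cV[R]_n)
    (w v : nat -> T -> R) (k : nat) : set (set T) :=
  <<s [set S | (exists i,
                   preimage_set_system [set: T] (fun t => zx t i 0)
                     (@measurable _ R) S \/
                   preimage_set_system [set: T] (fun t => zy t i 0)
                     (@measurable _ R) S) \/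
               (exists2 l, (l < k)%N &
                   preimage_set_system [set: T] (w l) (@measurable _ R) S \/
                   preimage_set_system [set: T] (v l) (@measurable _ R) S)] >>.

Definition admissible (d : measure_display) (T : measurableType d)
    (R : realType) (P : probability T R) (n m N : nat) (zx zy : T -> 'cV[R]_n)
    (w v : nat -> T -> R) (u : nat -> T -> 'cV[R]_m) : Prop :=
  forall k, (k < N)%N ->
    (forall i, measurable_wrt (info zx zy w v k) (fun t => u k t i 0)) /\
    square_integrable P (u k).

Fixpoint state_x (d : measure_display) (T : measurableType d) (R : realType)
    (P : probability T R) (n m : nat) (c : lq_coeffs R n m)
    (zx : T -> 'cV[R]_n) (w : nat -> T -> R) (u : nat -> T -> 'cV[R]_m)
    (k : nat) : T -> 'cV[R]_n :=
  if k is l.+1 then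
    let x := state_x P c zx w u l in
    fun t => (A_ c l *m x t + Ab_ c l *m Evec P x
              + B_ c l *m u l t + Bb_ c l *m Evec P (u l))
             + w l t *: (C_ c l *m x t + Cb_ c l *m Evec P x
                         + D_ c l *m u l t + Db_ c l *m Evec P (u l))
  else zx.

Fixpoint state_y (d : measure_display) (T : measurableType d) (R : realType)
    (P : probability T R) (n m : nat) (c : lq_coeffs R n m)
    (zy : T -> 'cV[R]_n) (v : nat -> T -> R) (k : nat) : T -> 'cV[R]_n :=
  if k is l.+1 then
    let y := state_y P c zy v l in
    fun t => (F_ c l *m y t + Fb_ c l *m Evec P y)
             + v l t *: (G_ c l *m y t + Gb_ c l *m Evec P y)
  else zy.

(* Extended-real valued: no finiteness of the expectations is built in. *)
Definition cost (d : measure_display) (T : measurableType d) (R : realType)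
    (P : probability T R) (n m : nat) (N : nat) (c : lq_coeffs R n m)
    (zx zy : T -> 'cV[R]_n) (w v : nat -> T -> R) (u : nat -> T -> 'cV[R]_m) :
    \bar R :=
  let e := fun k t => state_x P c zx w u k t - state_y P c zy v k t in
  (\sum_(k < N)
     'E_P[fun t => (quad (Q_ c k) (e k t) + quad (R_ c k) (u k t)
                    + quad (Qb_ c k) (Evec P (e k))
                    + quad (Rb_ c k) (Evec P (u k)))%R]
   + 'E_P[fun t => quad (Q_ c N) (e N t)]
   + (quad (Qb_ c N) (Evec P (e N)))%:E)%E.

(* Almost surely equal controls are identified in the uniqueness part. *)
Definition unique_minimizer (d : measure_display) (T : measurableType d)
    (R : realType) (P : probability T R) (n m : nat) (N : nat)
    (c : lq_coeffs R n m) (zx zy : T -> 'cV[R]_n) (w v : nat -> T -> R)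
    (u : nat -> T -> 'cV[R]_m) : Prop :=
  let adm := admissible P N zx zy w v in
  let J := cost P N c zx zy w v in
  [/\ adm u,
      forall u', adm u' -> (J u <= J u')%E &
      forall u', adm u' -> (forall u'', adm u'' -> (J u' <= J u'')%E) ->
        forall k, (k < N)%N -> {ae P, forall t, u' k t = u k t}].

(* The six Riccati matrices at a single time. *)
Record riccati (R : realType) (n : nat) := Riccati {
  Sx : 'M[R]_n;  Tx : 'M[R]_n;
  Sxy : 'M[R]_n; Txy : 'M[R]_n;
  Sy : 'M[R]_n;  Ty : 'M[R]_n
}.

(* In W1, W2, H1, H2, H3, H4 and riccati_step, p holds the matrices at time
   k + 1. *)
Definition W1 (R : realType) (n m : nat) (c : lq_coeffs R n m) (k : nat)
    (p : riccati R n) : 'M[R]_m :=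
  R_ c k + (B_ c k)^T *m Sx p *m B_ c k + (D_ c k)^T *m Sx p *m D_ c k.

Definition W2 (R : realType) (n m : nat) (c : lq_coeffs R n m) (k : nat)
    (p : riccati R n) : 'M[R]_m :=
  R_ c k + Rb_ c k
  + (B_ c k + Bb_ c k)^T *m Tx p *m (B_ c k + Bb_ c k)
  + (D_ c k + Db_ c k)^T *m Sx p *m (D_ c k + Db_ c k).

Definition H1 (R : realType) (n m : nat) (c : lq_coeffs R n m) (k : nat)
    (p : riccati R n) : 'M[R]_(n, m) :=
  (A_ c k)^T *m Sx p *m B_ c k + (C_ c k)^T *m Sx p *m D_ c k.

Definition H2 (R : realType) (n m : nat) (c : lq_coeffs R n m) (k : nat)
    (p : riccati R n) : 'M[R]_(n, m) :=
  (A_ c k + Ab_ c k)^T *m Tx p *m (B_ c k + Bb_ c k)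
  + (C_ c k + Cb_ c k)^T *m Sx p *m (D_ c k + Db_ c k).

Definition H3 (R : realType) (n m : nat) (c : lq_coeffs R n m) (k : nat)
    (p : riccati R n) : 'M[R]_(n, m) :=
  (F_ c k)^T *m Sxy p *m B_ c k
  + rho_ c *: ((G_ c k)^T *m Sxy p *m D_ c k).

Definition H4 (R : realType) (n m : nat) (c : lq_coeffs R n m) (k : nat)
    (p : riccati R n) : 'M[R]_(n, m) :=
  (F_ c k + Fb_ c k)^T *m Txy p *m (B_ c k + Bb_ c k)
  + rho_ c *: ((G_ c k + Gb_ c k)^T *m Sxy p *m (D_ c k + Db_ c k)).

Definition riccati_step (R : realType) (n m : nat) (c : lq_coeffs R n m)
    (k : nat) (p : riccati R n) : riccati R n := {|
  Sx := Q_ c k + (A_ c k)^T *m Sx p *m A_ c k + (C_ c k)^T *m Sx p *m C_ c k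
        - H1 c k p *m invmx (W1 c k p) *m (H1 c k p)^T;
  Tx := Q_ c k + Qb_ c k
        + (A_ c k + Ab_ c k)^T *m Tx p *m (A_ c k + Ab_ c k)
        + (C_ c k + Cb_ c k)^T *m Sx p *m (C_ c k + Cb_ c k)
        - H2 c k p *m invmx (W2 c k p) *m (H2 c k p)^T;
  Sxy := - Q_ c k + (F_ c k)^T *m Sxy p *m A_ c k
         + rho_ c *: ((G_ c k)^T *m Sxy p *m C_ c k)
         - H3 c k p *m invmx (W1 c k p) *m (H1 c k p)^T;
  Txy := - Q_ c k - Qb_ c k
         + (F_ c k + Fb_ c k)^T *m Txy p *m (A_ c k + Ab_ c k)
         + rho_ c *: ((G_ c k + Gb_ c k)^T *m Sxy p *m (C_ c k + Cb_ c k))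
         - H4 c k p *m invmx (W2 c k p) *m (H2 c k p)^T;
  Sy := Q_ c k + (F_ c k)^T *m Sy p *m F_ c k + (G_ c k)^T *m Sy p *m G_ c k
        - H3 c k p *m invmx (W1 c k p) *m (H3 c k p)^T;
  Ty := Q_ c k + Qb_ c k
        + (F_ c k + Fb_ c k)^T *m Ty p *m (F_ c k + Fb_ c k)
        + (G_ c k + Gb_ c k)^T *m Sy p *m (G_ c k + Gb_ c k)
        - H4 c k p *m invmx (W2 c k p) *m (H4 c k p)^T |}.

Definition riccati_end (R : realType) (n m : nat) (c : lq_coeffs R n m)
    (N : nat) : riccati R n := {|
  Sx := Q_ c N;    Tx := Q_ c N + Qb_ c N;
  Sxy := - Q_ c N; Txy := - Q_ c N - Qb_ c N;
  Sy := Q_ c N;    Ty := Q_ c N + Qb_ c N |}.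

(* Backward recursion: riccati_rev c N j is the solution at time N - j. *)
Fixpoint riccati_rev (R : realType) (n m : nat) (c : lq_coeffs R n m)
    (N j : nat) : riccati R n :=
  if j is i.+1 then riccati_step c (N - i.+1) (riccati_rev c N i)
  else riccati_end c N.

Definition riccati_sol (R : realType) (n m : nat) (c : lq_coeffs R n m)
    (N k : nat) : riccati R n := riccati_rev c N (N - k).

Lemma riccati_sol_end (R : realType) (n m : nat) (c : lq_coeffs R n m)
    (N : nat) : riccati_sol c N N = riccati_end c N.
Proof. by rewrite /riccati_sol subnn. Qed.

Lemma riccati_sol_step (R : realType) (n m : nat) (c : lq_coeffs R n m)
    (N k : nat) : (k < N)%N ->
  riccati_sol c N k = riccati_step c k (riccati_sol c N k.+1).
Proof.
move=> kN; rewrite /riccati_sol -(subnSK kN) /= (subnSK kN).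
by rewrite subKn// ltnW.
Qed.

(* u is given by the feedback law along its own trajectory. *)
Definition feedback_control (d : measure_display) (T : measurableType d)
    (R : realType) (P : probability T R) (n m : nat) (N : nat)
    (c : lq_coeffs R n m) (zx zy : T -> 'cV[R]_n) (w v : nat -> T -> R)
    (u : nat -> T -> 'cV[R]_m) : Prop :=
  forall k, (k < N)%N -> forall t,
    let x := state_x P c zx w u k in
    let y := state_y P c zy v k in
    let q := riccati_sol c N k.+1 in
    u k t = - (invmx (W1 c k q) *m (H1 c k q)^T *m (x t - Evec P x))
            - invmx (W2 c k q) *m (H2 c k q)^T *m Evec P x
            - invmx (W1 c k q) *m (H3 c k q)^T *m (y t - Evec P y)
            - invmx (W2 c k q) *m (H4 c k q)^T *m Evec P y.

(* Main.v *)
Require Import Defs.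
From mathcomp Require Import measurable_realfun ring lra.
Import Order.TTheory GRing.Theory Num.Theory.
Import numFieldNormedType.Exports.
Import HBNNSimple.
Set Implicit Arguments.
Unset Strict Implicit.
Unset Printing Implicit Defensive.
Local Open Scope classical_set_scope.
Local Open Scope ring_scope.

(** The cost is a quadratic function of the control, so for an admissible [u]
    one has [J u = J u* + 2 L + J0], where [L] is the first variation at [u*]
    in the direction [u - u*] and [J0] is the cost of [u - u*] for zero initial
    states and no tracking target.  Positivity of the weights gives [0 <= J0],
    with equality only if [u = u*] almost surely.  The first variation vanishes
    because its k-th summand is [E (p_k . dx_k) - E (p_(k+1) . dx_(k+1))] for
    the costate
    [p_k = Sx (x - E x) + Sxy^T (y - E y) + Tx (E x) + Txy^T (E y)],
    so that it telescopes to [E (p_0 . dx_0) = 0].  The matrices [Sy] and [Ty]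
    only enter the optimal value, hence do not occur here. *)

(** * Integration against functions measurable for a sub-sigma-algebra *)

(** Expectations in the dynamics couple all outcomes, so every pairing is split into a mean-zero
    fluctuation and a deterministic mean, which are orthogonal in L2. The fluctuation is governed by
    [Sx] and [Sxy], the mean by [Tx] and [Txy]; both levels obey the same algebra, which is proved
    once for generic matrices. They meet in the noise: a mean multiplied by [w k] has expectation
    zero and so joins the next fluctuation, which is why [Sx] and [Sxy] weight the noise
    coefficients also in the recursions of [Tx] and [Txy]. The state [y] is not controlled, so its
    noise [v k] meets a perturbation only through the correlation with [w k]; hence [rho_] in the
    cross recursions. The probabilistic obstacle is that the noise need not be independent of the
    past: only conditional first and second moments are known. Products of noise and past must first
    be shown integrable, and conditional moments are pulled out of expectations starting from
    equalities of integrals over sets of the sigma-algebra. *)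

Section SubSigmaAlgebra.
Context (R : realType) (d : measure_display) (T : measurableType d).
Variables (P : {measure set T -> \bar R}) (gen : set (set T)).
Hypothesis gen_sub : <<s gen >> `<=` @measurable _ T.
Local Notation T' := (g_sigma_algebraType gen).

(** Gives access to the closure properties of measurable functions, which are stated for a
    measurable type and not for a family of sets. *)
Lemma measurable_wrt_measurable_fun (f : T -> R) :
  measurable_wrt <<s gen >> f <-> measurable_fun [set: T'] (f : T' -> R).
Proof.
split=> [mf _ Y mY|mf S [Y mY <-]]; last exact: mf.
by apply: mf; exists Y.
Qed.

Lemma measurable_fun_subsigma (f : T' -> R) :
  measurable_fun [set: T'] f -> measurable_fun [set: T] (f : T -> R).
Proof. by move=> mf mT Y mY; apply: gen_sub; exact: mf. Qed.

Lemma measurable_nnsfun_preimage (h : {nnsfun T' >-> R}) (y : R) :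
  <<s gen >> ((h : T' -> R) @^-1` [set y]).
Proof.
have := @measurable_funPT _ _ _ _ h measurableT _ (measurable_set1 y).
by rewrite setTI.
Qed.

(** The level sets of [h] lie in the sub-sigma-algebra, so the right-hand side depends on [f] only
    through its integrals over such sets. *)
Lemma ge0_integral_mul_nnsfun (f : T -> \bar R) (h : {nnsfun T' >-> R}) :
  measurable_fun [set: T] f -> (forall t, 0 <= f t)%E ->
  (\int[P]_t (f t * ((h : T' -> R) t)%:E) =
   \sum_(y \in range (h : T' -> R))
      y%:E * \int[P]_(t in (h : T' -> R) @^-1` [set y]) f t)%E.
Proof.
move=> mf f0.
have mh y : @measurable _ T (h @^-1` [set y]).
  by apply: gen_sub; apply: measurable_nnsfun_preimage.
have mi y : measurable_fun [set: T] (\1_(h @^-1` [set y]) : T -> R).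
  exact: measurable_indic.
transitivity (\int[P]_t (\sum_(y \in range (h : T' -> R))
    (y * \1_(h @^-1` [set y]) t)%:E * f t))%E.
  apply: eq_integral => t _; rewrite fimfunE muleC -fsumEFin//.
  rewrite ge0_mule_fsuml// => y.
  exact: nnfun_muleindic_ge0.
rewrite ge0_integral_fsum//; last 2 first.
- move=> y; apply: emeasurable_funM => //; apply/measurable_EFinP.
  exact: measurable_funM.
- by move=> y t _; rewrite mule_ge0//; exact: nnfun_muleindic_ge0.
apply: eq_fsbigr => y /[!inE] -[t0 _ <-].
under eq_integral do rewrite EFinM -muleA.
have i0 t : (0 <= (\1_(h @^-1` [set h t0]) t)%:E * f t)%E.
  by rewrite mule_ge0// lee_fin.
have mif : measurable_fun [set: T]
    (fun t => (\1_(h @^-1` [set h t0]) t)%:E * f t)%E.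
  by apply: emeasurable_funM => //; apply/measurable_EFinP.
rewrite ge0_integralZl ?lee_fin//.
congr (_ * _)%E; rewrite [RHS]integral_mkcond.
apply: eq_integral => t _; by rewrite muleC epatch_indic.
Qed.

(** Monotone convergence along simple functions reduces this to level sets. Both sides may be
    infinite, so the identity can also be used to prove integrability. *)
Lemma ge0_integral_mul_subsigma (f g : T -> R) (h : T' -> R) :
  measurable_fun [set: T] f -> (forall t, 0 <= f t) ->
  measurable_fun [set: T] g -> (forall t, 0 <= g t) ->
  measurable_fun [set: T'] h -> (forall t, 0 <= h t) ->
  (forall S, <<s gen >> S ->
     \int[P]_(t in S) (f t)%:E = \int[P]_(t in S) (g t)%:E)%E ->
  (\int[P]_t (f t * h t)%:E = \int[P]_t (g t * h t)%:E)%E.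
Proof.
move=> mf f0 mg g0 mh h0 fg.
have mh' : measurable_fun [set: T'] (EFin \o h) by apply/measurable_EFinP.
(* The approximation is taken over [T'], so that each simple function is measurable for the
   sub-sigma-algebra and not only for the ambient one. *)
pose a := nnsfun_approx measurableT mh'.
have cvga (k : T -> R) : measurable_fun [set: T] k -> (forall t, 0 <= k t) ->
    (\int[P]_t (k t * h t)%:E =
     limn (fun n => \int[P]_t ((k t)%:E * ((a n : T' -> R) t)%:E)))%E.
  move=> mk k0.
  rewrite -monotone_convergence//; last 3 first.
  - move=> n; apply: emeasurable_funM; first exact/measurable_EFinP.
    by apply/measurable_EFinP/measurable_fun_subsigma; exact: measurable_funPT.
  - by move=> n t _; rewrite mule_ge0// lee_fin.
  - move=> t _ i j ij; rewrite lee_wpmul2l ?lee_fin//.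
    by move/lefP: (nd_nnsfun_approx measurableT mh' ij); apply.
  apply: eq_integral => t _; apply/esym/cvg_lim => //; rewrite EFinM.
  apply: cvgeZl => //.
  exact: (@cvg_nnsfun_approx _ _ _ _ measurableT _ mh' (fun x _ => h0 x) t I).
rewrite !cvga//; congr (lim (_ @ \oo)); apply/funext => n.
rewrite !ge0_integral_mul_nnsfun//; last 2 first.
- exact/measurable_EFinP.
- exact/measurable_EFinP.
apply: eq_fsbigr => y _.
by rewrite fg//; exact: measurable_nnsfun_preimage.
Qed.

End SubSigmaAlgebra.

(** * Square-integrable random variables and vectors *)

Section SquareIntegrable.
Context (R : realType) (d : measure_display) (T : measurableType d).
Variable P : probability T R.
Implicit Types f g h : T -> R.

Definition intg f := P.-integrable [set: T] (EFin \o f).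

Definition mean f : R := \int[P]_t f t.

Lemma fine_expectation f : fine ('E_P[f])%E = mean f.
Proof. by rewrite unlock. Qed.

Lemma expectation_intg f : intg f -> ('E_P[f] = (mean f)%:E)%E.
Proof.
move=> fi; rewrite -fine_expectation fineK// unlock.
exact: integrable_fin_num fi.
Qed.

Lemma intg_measurable f : intg f -> measurable_fun [set: T] f.
Proof. by move=> /measurable_int/measurable_EFinP. Qed.

Lemma intgD f g : intg f -> intg g -> intg (fun t => f t + g t).
Proof. by move=> fi gi; exact: (integrableD measurableT fi gi). Qed.

Lemma intgB f g : intg f -> intg g -> intg (fun t => f t - g t).
Proof. by move=> fi gi; exact: (integrableB measurableT fi gi). Qed.

Lemma intgZ a f : intg f -> intg (fun t => a * f t).
Proof. by move=> fi; exact: (integrableZl measurableT a fi). Qed.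

Lemma intg_cst a : intg (fun=> a).
Proof. exact: finite_measure_integrable_cst. Qed.

Lemma intg_norm f : intg f -> intg (fun t => `|f t|).
Proof. exact: integrable_norm. Qed.

Lemma intg_sum (I : Type) (s : seq I) (F : I -> T -> R) :
  (forall i, intg (F i)) -> intg (fun t => \sum_(i <- s) F i t).
Proof.
move=> Fi; elim: s => [|i s IHs].
  by under eq_fun do rewrite big_nil; exact: intg_cst.
by under eq_fun do rewrite big_cons; exact: intgD.
Qed.

Lemma intg_le f g : measurable_fun [set: T] f ->
  (forall t, `|f t| <= g t) -> intg g -> intg f.
Proof.
move=> mf fg gi.
apply: (@le_integrable _ _ _ P _ measurableT _ (EFin \o g)) => //.
  exact/measurable_EFinP.
by move=> t _ /=; rewrite lee_fin (le_trans (fg t))// ler_norm.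
Qed.

Lemma meanD f g : intg f -> intg g ->
  mean (fun t => f t + g t) = mean f + mean g.
Proof. exact: RintegralD. Qed.

Lemma meanB f g : intg f -> intg g ->
  mean (fun t => f t - g t) = mean f - mean g.
Proof. exact: RintegralB. Qed.

Lemma meanZ a f : intg f -> mean (fun t => a * f t) = a * mean f.
Proof. exact: RintegralZl. Qed.

Lemma mean_cst a : mean (fun=> a) = a.
Proof.
rewrite /mean Rintegral_cst// -[RHS]mulr1; congr (a * _).
exact: (congr1 fine (probability_setT P)).
Qed.

Lemma mean_sum (I : Type) (s : seq I) (F : I -> T -> R) :
  (forall i, intg (F i)) ->
  mean (fun t => \sum_(i <- s) F i t) = \sum_(i <- s) mean (F i).
Proof.
move=> Fi; elim: s => [|i s IHs].
  by under eq_fun do rewrite big_nil; rewrite big_nil mean_cst.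
under eq_fun do rewrite big_cons.
by rewrite meanD ?IHs ?big_cons//; exact: intg_sum.
Qed.

Lemma mean_ge0 f : (forall t, 0 <= f t) -> 0 <= mean f.
Proof. by move=> f0; exact: Rintegral_ge0. Qed.

Lemma mean_eq0_ae f : intg f -> (forall t, 0 <= f t) -> mean f = 0 ->
  {ae P, forall t, f t = 0}.
Proof.
move=> fi f0 mf0.
have mf : measurable_fun [set: T] (EFin \o f) by exact: measurable_int fi.
have /(ae_eq_integral_abs P measurableT mf) :
    (\int[P]_t `|(EFin \o f) t| = 0)%E.
  under eq_integral do rewrite gee0_abs ?lee_fin//.
  by rewrite -[LHS]fineK ?(integrable_fin_num measurableT fi)// [fine _]mf0.
by apply: filterS => t /(_ I) /= [].
Qed.

Definition l2 f := measurable_fun [set: T] f /\ intg (fun t => f t ^+ 2).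

Lemma intgM f g : l2 f -> l2 g -> intg (fun t => f t * g t).
Proof.
move=> [mf f2] [mg g2]; apply: intg_le (intgD f2 g2).
  exact: measurable_funM.
move=> t; rewrite ler_norml; apply/andP; split; nra.
Qed.

Lemma l2_cst a : l2 (fun=> a).
Proof. by split; [exact: measurable_cst|exact: intg_cst]. Qed.

Lemma l2Z a f : l2 f -> l2 (fun t => a * f t).
Proof.
move=> [mf f2]; split; first exact: measurable_funM.
by under eq_fun do rewrite exprMn; exact: intgZ.
Qed.

Lemma l2D f g : l2 f -> l2 g -> l2 (fun t => f t + g t).
Proof.
move=> fl gl; have fg := intgM fl gl; case: fl gl => [mf f2] [mg g2].
split; first exact: measurable_funD.
under eq_fun do rewrite sqrrD -mulr_natl.
by apply: intgD => //; apply: intgD => //; exact: intgZ.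
Qed.

Lemma l2_sum (I : Type) (s : seq I) (F : I -> T -> R) :
  (forall i, l2 (F i)) -> l2 (fun t => \sum_(i <- s) F i t).
Proof.
move=> Fi; elim: s => [|i s IHs].
  by under eq_fun do rewrite big_nil; exact: l2_cst.
by under eq_fun do rewrite big_cons; exact: l2D.
Qed.

Lemma l2_intg f : l2 f -> intg f.
Proof.
move=> fl; have := intgM fl (l2_cst 1).
by under eq_fun do rewrite mulr1.
Qed.

(** * Pulling out a constant conditional expectation *)

Section ConditionalExpectation.
Variable gen : set (set T).
Hypothesis gen_sub : <<s gen >> `<=` @measurable _ T.
Local Notation T' := (g_sigma_algebraType gen).

(* [f] and [g] below are nonnegative and differ by [X - c]. *)
Lemma ge0_mean_pull_out (X : T -> R) (c : R) (Z : T -> R) :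
  cond_expectation P <<s gen >> X (fun=> c) ->
  measurable_wrt <<s gen >> Z -> (forall t, 0 <= Z t) -> intg Z ->
  intg (fun t => X t * Z t) -> mean (fun t => X t * Z t) = c * mean Z.
Proof.
move=> [Xi ci _ Xc] mZ Z0 Zi XZi.
have aXi := intg_norm Xi.
pose g t := `|X t| + `|c|.
pose f t := g t + (X t - c).
have gi : intg g by apply: intgD => //; exact: intg_cst.
have fi : intg f by apply: intgD => //; exact: intgB.
have g0 t : 0 <= g t by rewrite addr_ge0.
have f0 t : 0 <= f t.
  have := ler_norm (- X t); have := ler_norm c; rewrite normrN /f /g; lra.
have fgS S : <<s gen >> S ->
    (\int[P]_(t in S) (f t)%:E = \int[P]_(t in S) (g t)%:E)%E.
  move=> GS; have mS := gen_sub GS.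
  have iS h : intg h -> P.-integrable S (EFin \o h).
    by move=> hi; exact: integrableS hi.
  rewrite (integralD_EFin mS (iS _ gi) (iS _ (intgB Xi ci))).
  rewrite (integralB_EFin mS (iS _ Xi) (iS _ ci)) Xc// subee ?adde0//.
  exact: integrable_fin_num (iS _ ci).
have := ge0_integral_mul_subsigma gen_sub (intg_measurable fi) f0
  (intg_measurable gi) g0 ((measurable_wrt_measurable_fun _ _).1 mZ) Z0 fgS.
have aXZi : intg (fun t => `|X t| * Z t).
  have := intg_norm XZi; under eq_fun do rewrite normrM (ger0_norm (Z0 _)).
  exact.
have gZi : intg (fun t => g t * Z t).
  by under eq_fun do rewrite mulrDl; apply: intgD => //; exact: intgZ.
have fZi : intg (fun t => f t * Z t).
  under eq_fun do rewrite mulrDl mulrBl.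
  by apply: intgD => //; apply: intgB => //; exact: intgZ.
move=> /(congr1 fine); rewrite -!/(Rintegral P setT _) -!/(mean _).
have -> : (fun t => f t * Z t) = (fun t => g t * Z t + (X t * Z t - c * Z t)).
  by apply/funext => t; rewrite /f; ring.
rewrite meanD ?meanB ?meanZ//;
  [|exact: intgZ|by apply: intgB => //; exact: intgZ].
by move=> fg; apply/eqP; rewrite -subr_eq0; apply/eqP; lra.
Qed.

(** Writes [Z] as the difference of [|Z| + Z] and [|Z|], both nonnegative and measurable for the
    same sigma-algebra. *)
Lemma mean_pull_out (X : T -> R) (c : R) (Z : T -> R) :
  cond_expectation P <<s gen >> X (fun=> c) ->
  measurable_wrt <<s gen >> Z -> intg Z ->
  intg (fun t => X t * Z t) -> mean (fun t => X t * Z t) = c * mean Z.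
Proof.
move=> cX mZ Zi XZi; case: (cX) => [Xi _ _ _].
have mZ' := (measurable_wrt_measurable_fun _ _).1 mZ.
have aZi := intg_norm Zi.
have maZ : measurable_fun [set: T'] (fun t : T' => `|Z t|).
  exact: measurableT_comp mZ'.
have mZ1 : measurable_fun [set: T'] (fun t : T' => `|Z t| + Z t).
  exact: measurable_funD.
have XaZi : intg (fun t => X t * `|Z t|).
  apply: intg_le (intg_norm XZi).
    apply: measurable_funM; first exact: intg_measurable.
    exact: intg_measurable aZi.
  by move=> t; rewrite !normrM normr_id.
have XZ1i : intg (fun t => X t * (`|Z t| + Z t)).
  by under eq_fun do rewrite mulrDr; exact: intgD.
have -> : (fun t => X t * Z t) =
    (fun t => X t * (`|Z t| + Z t) - X t * `|Z t|).
  by apply/funext => t; ring.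
have Z1_ge0 t : 0 <= `|Z t| + Z t.
  by have := ler_norm (- Z t); rewrite normrN; lra.
move/measurable_wrt_measurable_fun: maZ => maZ.
move/measurable_wrt_measurable_fun: mZ1 => mZ1.
rewrite meanB// (ge0_mean_pull_out cX maZ _ aZi XaZi)//.
rewrite (ge0_mean_pull_out cX mZ1 Z1_ge0 (intgD aZi Zi) XZ1i).
by rewrite meanD//; ring.
Qed.

(** Integrability of the product is here a conclusion: comparing [X] with the constant [c] in the
    extended reals bounds the integral by that of [c * Z]. With [X] the squared noise, this keeps
    the states square integrable. *)
Lemma ge0_intgM_pull_out (X : T -> R) (c : R) (Z : T -> R) :
  cond_expectation P <<s gen >> X (fun=> c) -> (forall t, 0 <= X t) -> 0 <= c ->
  measurable_wrt <<s gen >> Z -> (forall t, 0 <= Z t) -> intg Z ->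
  intg (fun t => X t * Z t).
Proof.
move=> [Xi ci _ Xc] X0 c0 mZ Z0 Zi.
have mX := intg_measurable Xi; have mZT := intg_measurable Zi.
apply/integrableP; split.
  by apply/measurable_EFinP; exact: measurable_funM.
under eq_integral do rewrite gee0_abs ?lee_fin ?mulr_ge0//.
have mc : measurable_fun [set: T] (fun=> c) by exact: measurable_cst.
rewrite (ge0_integral_mul_subsigma gen_sub mX X0 mc)//.
  exact: integrable_lty (intgZ c Zi).
exact/measurable_wrt_measurable_fun.
Qed.

End ConditionalExpectation.

End SquareIntegrable.

(** * The Euclidean inner product *)

Section Dot.
Variable R : realType.

Definition dot (p : nat) (x y : 'cV[R]_p) : R := (x^T *m y) 0 0.

Lemma dotE p (x y : 'cV[R]_p) : dot x y = \sum_i x i 0 * y i 0.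
Proof. by rewrite /dot mxE; apply: eq_bigr => i _; rewrite mxE. Qed.

Lemma dotC p (x y : 'cV[R]_p) : dot x y = dot y x.
Proof. by rewrite !dotE; apply: eq_bigr => i _; rewrite mulrC. Qed.

Lemma dotDl p (x y z : 'cV[R]_p) : dot (x + y) z = dot x z + dot y z.
Proof. by rewrite /dot linearD mulmxDl mxE. Qed.

Lemma dotDr p (x y z : 'cV[R]_p) : dot z (x + y) = dot z x + dot z y.
Proof. by rewrite !(dotC z) dotDl. Qed.

Lemma dotZl p a (x y : 'cV[R]_p) : dot (a *: x) y = a * dot x y.
Proof. by rewrite /dot linearZ -scalemxAl mxE. Qed.

Lemma dotZr p a (x y : 'cV[R]_p) : dot x (a *: y) = a * dot x y.
Proof. by rewrite dotC dotZl dotC. Qed.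

Lemma dot0l p (y : 'cV[R]_p) : dot 0 y = 0.
Proof. by rewrite -(scale0r y) dotZl mul0r. Qed.

Lemma dotNl p (x y : 'cV[R]_p) : dot (- x) y = - dot x y.
Proof. by rewrite -scaleN1r dotZl mulN1r. Qed.

Lemma dot_mulmxr p q (M : 'M[R]_(p, q)) x y : dot x (M *m y) = dot (M^T *m x) y.
Proof. by rewrite /dot trmx_mul trmxK mulmxA. Qed.

Lemma dot_mulmxl p q (M : 'M[R]_(p, q)) x y : dot (M *m x) y = dot x (M^T *m y).
Proof. by rewrite dot_mulmxr trmxK. Qed.

Lemma quad_dot p (M : 'M[R]_p) x : quad M x = dot x (M *m x).
Proof. by rewrite /quad /dot mulmxA. Qed.

End Dot.

(** * Square-integrable random vectors, their means and inner products *)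

Section RandomVectors.
Context (R : realType) (d : measure_display) (T : measurableType d).
Variable P : probability T R.

Definition L2 p (X : T -> 'cV[R]_p) := forall i, l2 P (fun t => X t i 0).

Lemma square_integrableP p (X : T -> 'cV[R]_p) : square_integrable P X <-> L2 X.
Proof.
split=> [[mX EX] i|XL].
  split=> //; have mX2 j : measurable_fun [set: T] (fun t => X t j 0 ^+ 2).
    exact: measurable_funX.
  apply: (@intg_le _ _ _ P _ (fun t => sqnorm (X t))) => //.
    move=> t; rewrite ger0_norm ?sqr_ge0// /sqnorm (bigD1 i)//= lerDl.
    by rewrite sumr_ge0// => j _; exact: sqr_ge0.
  apply/integrableP; split.
    by apply/measurable_EFinP; exact: measurable_sum.
  move: EX; rewrite unlock; congr (_ < _)%E; apply: eq_integral => t _ /=.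
  by rewrite ger0_norm// sumr_ge0// => j _; exact: sqr_ge0.
split=> [i|]; first by case: (XL i).
have /integrable_lty -/(_ measurableT) : intg P (fun t => sqnorm (X t)).
  by apply: intg_sum => i; case: (XL i).
by rewrite unlock.
Qed.

Lemma L2D p (X Y : T -> 'cV[R]_p) : L2 X -> L2 Y -> L2 (fun t => X t + Y t).
Proof.
by move=> XL YL i; under eq_fun do rewrite mxE; exact: l2D.
Qed.

Lemma L2mx p q (M : 'M[R]_(p, q)) X : L2 X -> L2 (fun t => M *m X t).
Proof.
move=> XL i; under eq_fun do rewrite mxE.
by apply: l2_sum => j; exact: l2Z.
Qed.

Lemma L2N p (X : T -> 'cV[R]_p) : L2 X -> L2 (fun t => - X t).
Proof.
move=> XL; have := L2mx (- 1%:M) XL.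
by under eq_fun do rewrite mulNmx mul1mx.
Qed.

Lemma L2cst p (a : 'cV[R]_p) : L2 (fun=> a).
Proof. by move=> i; exact: l2_cst. Qed.

Lemma L2B p (X Y : T -> 'cV[R]_p) : L2 X -> L2 Y -> L2 (fun t => X t - Y t).
Proof. by move=> XL YL; exact: L2D XL (L2N YL). Qed.

Lemma intg_dot p (X Y : T -> 'cV[R]_p) :
  L2 X -> L2 Y -> intg P (fun t => dot (X t) (Y t)).
Proof.
move=> XL YL; under eq_fun do rewrite dotE.
by apply: intg_sum => i; exact: intgM.
Qed.

Lemma EvecE p (X : T -> 'cV[R]_p) i :
  Evec P X i 0 = mean P (fun t => X t i 0).
Proof. by rewrite mxE fine_expectation. Qed.

Lemma EvecD p (X Y : T -> 'cV[R]_p) : L2 X -> L2 Y ->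
  Evec P (fun t => X t + Y t) = Evec P X + Evec P Y.
Proof.
move=> XL YL; apply/colP => i.
rewrite [RHS]mxE !EvecE -meanD; try exact: l2_intg.
by congr mean; apply/funext => t; rewrite mxE.
Qed.

Lemma Evec_mulmx p q (M : 'M[R]_(p, q)) X : L2 X ->
  Evec P (fun t => M *m X t) = M *m Evec P X.
Proof.
move=> XL; apply/colP => i; rewrite [RHS]mxE EvecE.
under eq_fun do rewrite mxE.
rewrite mean_sum; last by move=> j; exact/l2_intg/l2Z.
by apply: eq_bigr => j _; rewrite meanZ ?EvecE//; exact: l2_intg.
Qed.

Lemma EvecN p (X : T -> 'cV[R]_p) : L2 X ->
  Evec P (fun t => - X t) = - Evec P X.
Proof.
move=> XL; have := Evec_mulmx (- 1%:M) XL.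
by under eq_fun do rewrite mulNmx mul1mx; rewrite mulNmx mul1mx.
Qed.

Lemma EvecB p (X Y : T -> 'cV[R]_p) : L2 X -> L2 Y ->
  Evec P (fun t => X t - Y t) = Evec P X - Evec P Y.
Proof. by move=> XL YL; rewrite EvecD ?EvecN//; exact: L2N. Qed.

Lemma Evec_cst p (a : 'cV[R]_p) : Evec P (fun=> a) = a.
Proof. by apply/colP => i; rewrite EvecE mean_cst. Qed.

Definition ip p (X Y : T -> 'cV[R]_p) : R := mean P (fun t => dot (X t) (Y t)).

Lemma ipDl p (X Y Z : T -> 'cV[R]_p) : L2 X -> L2 Y -> L2 Z ->
  ip (fun t => X t + Y t) Z = ip X Z + ip Y Z.
Proof.
move=> XL YL ZL; rewrite /ip -meanD; try exact: intg_dot.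
by congr mean; apply/funext => t; rewrite dotDl.
Qed.

Lemma ipNl p (X Z : T -> 'cV[R]_p) : L2 X -> L2 Z ->
  ip (fun t => - X t) Z = - ip X Z.
Proof.
move=> XL ZL; rewrite -mulN1r /ip -meanZ; last exact: intg_dot.
by congr mean; apply/funext => t; rewrite dotNl mulN1r.
Qed.

Lemma ipBl p (X Y Z : T -> 'cV[R]_p) : L2 X -> L2 Y -> L2 Z ->
  ip (fun t => X t - Y t) Z = ip X Z - ip Y Z.
Proof. by move=> XL YL ZL; rewrite ipDl ?ipNl//; exact: L2N. Qed.

Lemma ipC p (X Y : T -> 'cV[R]_p) : ip X Y = ip Y X.
Proof. by congr mean; apply/funext => t; exact: dotC. Qed.

Lemma ipDr p (X Y Z : T -> 'cV[R]_p) : L2 X -> L2 Y -> L2 Z ->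
  ip Z (fun t => X t + Y t) = ip Z X + ip Z Y.
Proof. by move=> XL YL ZL; rewrite !(ipC Z) ipDl. Qed.

Lemma ip_mulmxr p q (M : 'M[R]_(p, q)) X Y :
  ip X (fun t => M *m Y t) = ip (fun t => M^T *m X t) Y.
Proof. by congr mean; apply/funext => t; exact: dot_mulmxr. Qed.

Lemma ip_cstr p (X : T -> 'cV[R]_p) a : L2 X ->
  ip X (fun=> a) = dot (Evec P X) a.
Proof.
move=> XL; rewrite /ip dotE; under eq_fun do rewrite dotE.
rewrite mean_sum; last by move=> i; apply: intgM => //; exact: l2_cst.
apply: eq_bigr => i _; rewrite EvecE mulrC -meanZ; last exact: l2_intg.
by congr mean; apply/funext => t; rewrite mulrC.
Qed.

Definition centered p (X : T -> 'cV[R]_p) t := X t - Evec P X.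

Lemma L2_centered p (X : T -> 'cV[R]_p) : L2 X -> L2 (centered X).
Proof. by move=> XL; apply: L2B => //; exact: L2cst. Qed.

Lemma Evec_centered p (X : T -> 'cV[R]_p) : L2 X -> Evec P (centered X) = 0.
Proof. by move=> XL; rewrite EvecB ?Evec_cst ?subrr//; exact: L2cst. Qed.

(** * Vectors measurable for the past, and their products with the noise *)

Section Adapted.
Variable gen : set (set T).
Local Notation T' := (g_sigma_algebraType gen).

(** For [gen] generating the information at time k, these are the candidates for states and controls
    at that time. *)
Definition L2wrt p (X : T -> 'cV[R]_p) :=
  (forall i, measurable_wrt <<s gen >> (fun t => X t i 0)) /\ L2 X.

Lemma L2wrt_cst p (a : 'cV[R]_p) : L2wrt (fun=> a).
Proof.
split; last exact: L2cst.
by move=> i; apply/measurable_wrt_measurable_fun; exact: measurable_cst.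
Qed.

Lemma L2wrtD p (X Y : T -> 'cV[R]_p) :
  L2wrt X -> L2wrt Y -> L2wrt (fun t => X t + Y t).
Proof.
move=> [mX XL] [mY YL]; split; last exact: L2D.
move=> i; under eq_fun do rewrite mxE; apply/measurable_wrt_measurable_fun.
by apply: measurable_funD; apply/measurable_wrt_measurable_fun.
Qed.

Lemma L2wrt_mx p q (M : 'M[R]_(p, q)) X : L2wrt X -> L2wrt (fun t => M *m X t).
Proof.
move=> [mX XL]; split; last exact: L2mx.
move=> i; under eq_fun do rewrite mxE; apply/measurable_wrt_measurable_fun.
apply: (@measurable_sum _ T') => j; apply: measurable_funM => //.
exact/measurable_wrt_measurable_fun.
Qed.

Lemma L2wrtN p (X : T -> 'cV[R]_p) : L2wrt X -> L2wrt (fun t => - X t).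
Proof.
move=> XL; have := L2wrt_mx (- 1%:M) XL.
by under eq_fun do rewrite mulNmx mul1mx.
Qed.

Lemma L2wrtB p (X Y : T -> 'cV[R]_p) :
  L2wrt X -> L2wrt Y -> L2wrt (fun t => X t - Y t).
Proof. by move=> XL YL; exact: L2wrtD XL (L2wrtN YL). Qed.

Lemma L2wrt_centered p (X : T -> 'cV[R]_p) : L2wrt X -> L2wrt (centered X).
Proof. by move=> XL; apply: L2wrtB => //; exact: L2wrt_cst. Qed.

Lemma measurable_wrt_dot p (X Y : T -> 'cV[R]_p) : L2wrt X -> L2wrt Y ->
  measurable_wrt <<s gen >> (fun t => dot (X t) (Y t)).
Proof.
move=> [mX _] [mY _]; under eq_fun do rewrite dotE.
apply/measurable_wrt_measurable_fun.
by apply: (@measurable_sum _ T') => j; apply: measurable_funM;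
  apply/measurable_wrt_measurable_fun.
Qed.

Hypothesis gen_sub : <<s gen >> `<=` @measurable _ T.

(** The squared coordinates of [X] are past-measurable, and the squared noise has conditional
    expectation 1, so second moments are finite. *)
Lemma L2_noise p (w : T -> R) (X : T -> 'cV[R]_p) :
  measurable_fun [set: T] w ->
  cond_expectation P <<s gen >> (fun t => w t ^+ 2) (fun=> 1) ->
  L2wrt X -> L2 (fun t => w t *: X t).
Proof.
move=> mw w2 [mX XL] i; under eq_fun do rewrite mxE.
have [mXi Xi2] := XL i.
split; first exact: measurable_funM.
under eq_fun do rewrite exprMn.
apply: (ge0_intgM_pull_out gen_sub w2) => //.
- by move=> t; exact: sqr_ge0.
- apply/measurable_wrt_measurable_fun/measurable_funX.
  exact/measurable_wrt_measurable_fun.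
- by move=> t; exact: sqr_ge0.
Qed.

Lemma Evec_noise p (w : T -> R) (X : T -> 'cV[R]_p) :
  cond_expectation P <<s gen >> w (fun=> 0) ->
  L2wrt X -> L2 (fun t => w t *: X t) -> Evec P (fun t => w t *: X t) = 0.
Proof.
move=> w0 [mX XL] wX; apply/colP => i; rewrite EvecE [RHS]mxE.
under eq_fun do rewrite mxE.
rewrite (mean_pull_out gen_sub w0) ?mul0r//; first exact: l2_intg.
by have /l2_intg := wX i; under eq_fun do rewrite mxE.
Qed.

(** A term carrying a single noise factor averages to zero, [w * w] averages to 1 and [w * v] to
    [rho]. The second argument has no [v] term because it stands for a perturbation of [x], which
    [v] does not drive directly. *)
Lemma ip_noise p (w v : T -> R) (rho : R) (X Y Z X' Y' : T -> 'cV[R]_p) :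
  measurable_fun [set: T] w -> measurable_fun [set: T] v ->
  cond_expectation P <<s gen >> w (fun=> 0) ->
  cond_expectation P <<s gen >> v (fun=> 0) ->
  cond_expectation P <<s gen >> (fun t => w t ^+ 2) (fun=> 1) ->
  cond_expectation P <<s gen >> (fun t => v t ^+ 2) (fun=> 1) ->
  cond_expectation P <<s gen >> (fun t => w t * v t) (fun=> rho) ->
  L2wrt X -> L2wrt Y -> L2wrt Z -> L2wrt X' -> L2wrt Y' ->
  ip (fun t => X t + w t *: Y t + v t *: Z t) (fun t => X' t + w t *: Y' t) =
  ip X X' + ip (fun t => Y t + rho *: Z t) Y'.
Proof.
move=> mw mv w0 v0 w2 v2 wv XL YL ZL X'L Y'L.
have wY := L2_noise mw w2 YL; have vZ := L2_noise mv v2 ZL.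
have wY' := L2_noise mw w2 Y'L.
have rZ : L2wrt (fun t => rho *: Z t).
  have := L2wrt_mx rho%:M ZL; by under eq_fun do rewrite mul_scalar_mx.
(* Each product with noise is an instance, with [s] one of [w], [v], [w ^+ 2] and [w * v];
   integrability comes from [L2_noise] in every case. *)
have pull (s : T -> R) c (U V : T -> 'cV[R]_p) :
    cond_expectation P <<s gen >> s (fun=> c) -> L2wrt U -> L2wrt V ->
    intg P (fun t => s t * dot (U t) (V t)) ->
    mean P (fun t => s t * dot (U t) (V t)) = c * ip U V.
  move=> sc UL VL; apply: (mean_pull_out gen_sub sc).
    exact: measurable_wrt_dot.
  by apply: intg_dot; [case: UL|case: VL].
case: (XL) (YL) (ZL) (X'L) (Y'L) (rZ)
  => [_ X2] [_ Y2] [_ Z2] [_ X'2] [_ Y'2] [_ rZ2].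
rewrite ipDl//; [|exact: L2D|exact: L2D].
rewrite ipDl//; [|exact: L2D].
rewrite !ipDr// ipDl//.
have -> : ip X (fun t => w t *: Y' t) = 0.
  rewrite -(mul0r (ip X Y')) -(pull w)//.
    by congr mean; apply/funext => t; rewrite dotZr.
  by have := intg_dot X2 wY'; under eq_fun do rewrite dotZr.
have -> : ip (fun t => w t *: Y t) X' = 0.
  rewrite -(mul0r (ip Y X')) -(pull w)//.
    by congr mean; apply/funext => t; rewrite dotZl.
  by have := intg_dot wY X'2; under eq_fun do rewrite dotZl.
have -> : ip (fun t => v t *: Z t) X' = 0.
  rewrite -(mul0r (ip Z X')) -(pull v)//.
    by congr mean; apply/funext => t; rewrite dotZl.
  by have := intg_dot vZ X'2; under eq_fun do rewrite dotZl.
have -> : ip (fun t => w t *: Y t) (fun t => w t *: Y' t) = ip Y Y'.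
  rewrite -[RHS]mul1r -(pull (fun t => w t ^+ 2))//.
    by congr mean; apply/funext => t; rewrite dotZl dotZr mulrA.
  have := intg_dot wY wY'; under eq_fun do rewrite dotZl dotZr mulrA.
  exact.
have -> : ip (fun t => v t *: Z t) (fun t => w t *: Y' t) = rho * ip Z Y'.
  rewrite -(pull (fun t => w t * v t))//.
    by congr mean; apply/funext => t; rewrite dotZl dotZr mulrA (mulrC (v t)).
  have := intg_dot vZ wY'.
  under eq_fun do rewrite dotZl dotZr mulrA (mulrC (v _)).
  exact.
have -> : ip (fun t => rho *: Z t) Y' = rho * ip Z Y'.
  rewrite -meanZ; last exact: intg_dot.
  by congr mean; apply/funext => t; rewrite dotZl.
by ring.
Qed.

End Adapted.

End RandomVectors.

(** * Positive definiteness and one Riccati step *)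

Section Definite.
Variable R : realType.

Lemma dotNr p (x y : 'cV[R]_p) : dot x (- y) = - dot x y.
Proof. by rewrite dotC dotNl dotC. Qed.

(** Testing against [z] turns an identity between column vectors, where [ring] does not apply, into
    a scalar one that it closes. *)
Lemma dot_inj p (x y : 'cV[R]_p) : (forall z, dot z x = dot z y) -> x = y.
Proof.
move=> xy; apply/colP => i; have := xy (delta_mx i 0).
by rewrite /dot !trmx_delta -!rowE !mxE.
Qed.

Lemma tr_mxD p q (A B : 'M[R]_(p, q)) : (A + B)^T = A^T + B^T.
Proof. exact: linearD. Qed.

Lemma tr_mxB p q (A B : 'M[R]_(p, q)) : (A - B)^T = A^T - B^T.
Proof. exact: linearB. Qed.

Lemma tr_mxN p q (A : 'M[R]_(p, q)) : (- A)^T = - A^T.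
Proof. exact: linearN. Qed.

Lemma tr_mxZ p q a (A : 'M[R]_(p, q)) : (a *: A)^T = a *: A^T.
Proof. exact: linearZ. Qed.

Lemma symmetric_mxD p (M M' : 'M[R]_p) :
  symmetric_mx M -> symmetric_mx M' -> symmetric_mx (M + M').
Proof. by rewrite /symmetric_mx tr_mxD => -> ->. Qed.

Lemma posdef_psd p (M : 'M[R]_p) : posdef M -> psd M.
Proof.
move=> Mp x; have [->|/Mp/ltW//] := eqVneq x 0.
by rewrite /quad mulmx0 mxE.
Qed.

(** A nonzero row vector in the left kernel would have a vanishing quadratic form. *)
Lemma posdef_unitmx p (M : 'M[R]_p) : posdef M -> M \in unitmx.
Proof.
move=> Mp; rewrite -row_free_unit -kermx_eq0; apply/rowV0P => v /sub_kermxP vM.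
apply/eqP; apply: contraT => v0.
have := Mp v^T; rewrite trmx_eq0 => /(_ v0).
by rewrite /quad trmxK vM mul0mx mxE ltxx.
Qed.

Lemma quadD p (M1 M2 : 'M[R]_p) x : quad (M1 + M2) x = quad M1 x + quad M2 x.
Proof. by rewrite /quad mulmxDr mulmxDl mxE. Qed.

Lemma quad_congr p q (S : 'M[R]_p) (B : 'M[R]_(p, q)) x :
  quad (B^T *m S *m B) x = quad S (B *m x).
Proof. by rewrite /quad trmx_mul !mulmxA. Qed.

Section RiccatiStep.
Variables (n m : nat) (Q A C F G S1 S2 V1 V2 : 'M[R]_n) (M : 'M[R]_m).
Variables (B D : 'M[R]_(n, m)) (rho : R).
Hypotheses (symM : symmetric_mx M) (symQ : symmetric_mx Q).
Hypotheses (symS1 : symmetric_mx S1) (symS2 : symmetric_mx S2).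
Hypotheses (posM : posdef M) (psdQ : psd Q) (psdS1 : psd S1) (psdS2 : psd S2).

(** One template for two recursions. The fluctuation takes [S1 = S2 = Sx], [V1 = V2 = Sxy] and the
    plain coefficients; the mean takes [S1 = Tx], [V1 = Txy] and sums with the barred coefficients,
    but keeps [S2 = Sx] and [V2 = Sxy] for the noise. *)
Let W := M + B^T *m S1 *m B + D^T *m S2 *m D.
Let H := A^T *m S1 *m B + C^T *m S2 *m D.
Let H' := F^T *m V1 *m B + rho *: (G^T *m V2 *m D).

Lemma posdef_W : posdef W.
Proof.
move=> x x0; rewrite !quadD !quad_congr.
have := posM x0; have := psdS1 (B *m x); have := psdS2 (D *m x); lra.
Qed.

Lemma sym_W : symmetric_mx W.
Proof.
by rewrite /symmetric_mx !tr_mxD !trmx_mul !trmxK symM symS1 symS2 !mulmxA.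
Qed.

Lemma sym_invW : (invmx W)^T = invmx W.
Proof. by rewrite trmx_inv sym_W. Qed.

Let S := Q + A^T *m S1 *m A + C^T *m S2 *m C - H *m invmx W *m H^T.

Lemma sym_riccati_step : symmetric_mx S.
Proof.
rewrite /symmetric_mx tr_mxB 2!tr_mxD.
have -> : (H *m invmx W *m H^T)^T = H *m invmx W *m H^T.
  by rewrite trmx_mul trmxK trmx_mul sym_invW mulmxA.
by rewrite !trmx_mul !trmxK symQ symS1 symS2 !mulmxA.
Qed.

(* [S] is the minimum over [u] of a nonnegative quadratic form in [(x, u)]. *)
Lemma psd_riccati_step : psd S.
Proof.
(* The minimizer for given [x], that is, the solution of [W *m u = - (H^T *m x)]. *)
move=> x; pose u := - (invmx W *m H^T *m x).
suff -> : quad S x = quad Q x + quad M u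
    + quad S1 (A *m x + B *m u) + quad S2 (C *m x + D *m u).
  have := psdQ x; have := posdef_psd posM u.
  have := psdS1 (A *m x + B *m u); have := psdS2 (C *m x + D *m u); lra.
have Wu : W *m u = - (H^T *m x).
  by rewrite mulmxN -!mulmxA mulKVmx//; exact: posdef_unitmx posdef_W.
have quadDv (K : 'M[R]_n) (y z : 'cV[R]_n) : symmetric_mx K ->
    quad K (y + z) = quad K y + 2 * dot y (K *m z) + quad K z.
  move=> symK; rewrite !quad_dot mulmxDr !dotDl !dotDr (dotC z (K *m y)).
  by rewrite dot_mulmxl symK; ring.
have Hxu : dot x (H *m u) =
    dot x (A^T *m S1 *m B *m u) + dot x (C^T *m S2 *m D *m u).
  by rewrite mulmxDl dotDr.
rewrite !quadDv//.
(* At the minimizer the part quadratic in [u] cancels half of the cross term [2 * dot x (H *m u)];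
   the other half is the subtracted term of [S]. *)
have uWu : quad M u + quad S1 (B *m u) + quad S2 (D *m u) = - dot x (H *m u).
  by rewrite -!quad_congr -!quadD -/W quad_dot Wu dotC dotNl -dot_mulmxr.
rewrite !dot_mulmxl in Hxu *; rewrite !mulmxA.
have -> : quad S x =
    quad Q x + quad S1 (A *m x) + quad S2 (C *m x) + dot x (H *m u).
  rewrite -!quad_congr -!quadD quad_dot [in RHS]quad_dot -dotDr.
  by rewrite mulmxBl mulmxN !mulmxA.
by rewrite -!mulmxA in Hxu *; lra.
Qed.

Section Stationarity.
Variables x y : 'cV[R]_n.
Let u := - (invmx W *m H^T *m x) - invmx W *m H'^T *m y.
(** Given the past, [a] stands for the prediction of the next costate and [b] for the prediction of
    its product with [w]; the [y] noise enters [b] only with the factor [rho]. *)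
Let a := S1 *m (A *m x + B *m u) + V1^T *m (F *m y).
Let b := S2 *m (C *m x + D *m u) + rho *: (V2^T *m (G *m y)).

(** The first-order condition in the control, which determines the feedback gains. *)
Lemma stationarity_control : B^T *m a + D^T *m b = - (M *m u).
Proof.
have Wu : W *m u = - (H^T *m x) - H'^T *m y.
  have uW := posdef_unitmx posdef_W.
  by rewrite mulmxBr mulmxN -!mulmxA !mulKVmx.
(* Trading [M] for [W] removes the inverse, since [W *m u] is known explicitly. *)
have -> : - (M *m u) = B^T *m S1 *m B *m u + D^T *m S2 *m D *m u - W *m u.
  by apply/dot_inj => z; rewrite /W !mulmxDl !(dotDr, dotNr); ring.
apply/dot_inj => z; rewrite Wu /H /H' !tr_mxD tr_mxZ !trmx_mul !trmxK.
rewrite symS1 symS2 /a /b !mulmxDl !mulmxDr -!scalemxAr -!scalemxAl !mulmxA.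
by rewrite !(dotDr, dotNr, dotZr); ring.
Qed.

(** The adjoint equation: expanding [u] in [a] and [b] produces [H *m u], whose two parts are the
    subtracted terms of the recursions for [S] and for the cross matrix. *)
Lemma stationarity_state :
  A^T *m a + C^T *m b =
  S *m x + (- Q + F^T *m V1 *m A + rho *: (G^T *m V2 *m C)
            - H' *m invmx W *m H^T)^T *m y - Q *m (x - y).
Proof.
apply/dot_inj => z; 
have HH : (H' *m invmx W *m H^T)^T = H *m invmx W *m H'^T.
  by rewrite trmx_mul trmxK trmx_mul sym_invW mulmxA.
rewrite tr_mxB HH 2!tr_mxD tr_mxZ tr_mxN !trmx_mul.
rewrite !trmxK symQ /a /b /S /u
  !(mulmxBl, mulmxDl, mulmxBr, mulmxDr, mulNmx).
rewrite -!scalemxAr -!scalemxAl !(mulmxBl, mulmxDl, mulmxN) !mulmxA.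
by rewrite !(dotDr, dotNr, dotZr); ring.
Qed.

End Stationarity.

End RiccatiStep.

End Definite.

(** * Mean-field quadratic forms and the costate recursion *)

Section MeanFieldForm.
Context (R : realType) (d : measure_display) (T : measurableType d).
Variable P : probability T R.

(** Mean-zero vectors are orthogonal to constants; this decouples fluctuations from means. *)
Lemma ip_addcst p (X Y : T -> 'cV[R]_p) a b :
  L2 P X -> L2 P Y -> Evec P X = 0 -> Evec P Y = 0 ->
  ip P (fun t => X t + a) (fun t => Y t + b) = ip P X Y + dot a b.
Proof.
move=> XL YL X0 Y0.
have ca := L2cst P a; have cb := L2cst P b.
rewrite (ipDl XL ca (L2D YL cb)) !(ipDr YL cb)// (ip_cstr _ XL) X0.
rewrite (ipC _ (fun=> a) Y) (ip_cstr _ YL) Y0 (ip_cstr _ ca) Evec_cst.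
by rewrite !dot0l addr0 add0r.
Qed.

(* The mean-field quadratic form, polarized: its diagonal is
   [E (X^T M X) + (E X)^T Mb (E X)]. *)
Definition bil p (M Mb : 'M[R]_p) (X Y : T -> 'cV[R]_p) : R :=
  ip P (fun t => M *m X t) Y + dot (Mb *m Evec P X) (Evec P Y).

(** Explains the assumptions on the weights: fluctuations see [M] alone, means see [M + Mb]. *)
Lemma bil_centered p (M Mb : 'M[R]_p) (X Y : T -> 'cV[R]_p) :
  L2 P X -> L2 P Y ->
  bil M Mb X Y = ip P (fun t => M *m centered P X t) (centered P Y) +
                 dot ((M + Mb) *m Evec P X) (Evec P Y).
Proof.
move=> XL YL; have cX := L2_centered XL; have cY := L2_centered YL.
have E (Z : T -> 'cV[R]_p) : Z = fun t => centered P Z t + Evec P Z.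
  by apply/funext => t; rewrite subrK.
rewrite /bil {1}(E X) {1}(E Y).
under [X in ip P X _]eq_fun do rewrite mulmxDr.
rewrite ip_addcst ?Evec_mulmx ?Evec_centered ?mulmx0//; last exact: L2mx.
by rewrite mulmxDl dotDl addrA.
Qed.

Lemma bil_sqrD p (M Mb : 'M[R]_p) (X Y : T -> 'cV[R]_p) :
  symmetric_mx M -> symmetric_mx Mb -> L2 P X -> L2 P Y ->
  bil M Mb (fun t => X t + Y t) (fun t => X t + Y t) =
  bil M Mb X X + 2 * bil M Mb X Y + bil M Mb Y Y.
Proof.
move=> sM sMb XL YL.
have mX := L2mx M XL; have mY := L2mx M YL.
have -> : bil M Mb (fun t => X t + Y t) (fun t => X t + Y t) =
    ip P (fun t => M *m X t + M *m Y t) (fun t => X t + Y t) +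
    dot (Mb *m Evec P (fun t => X t + Y t)) (Evec P (fun t => X t + Y t)).
  by rewrite /bil; under [X in ip P X _]eq_fun do rewrite mulmxDr.
rewrite /bil (ipDl mX mY (L2D XL YL)) !(ipDr XL YL)// EvecD// mulmxDr.
rewrite !(dotDl, dotDr).
have -> : ip P (fun t => M *m Y t) X = ip P (fun t => M *m X t) Y.
  by rewrite ipC ip_mulmxr sM.
rewrite (dotC (Mb *m Evec P Y) (Evec P X)) dot_mulmxr sMb.
by ring.
Qed.

Lemma bil_ge0 p (M Mb : 'M[R]_p) X :
  psd M -> psd (M + Mb) -> L2 P X -> 0 <= bil M Mb X X.
Proof.
move=> pM pMb XL; rewrite bil_centered// addr_ge0//; last first.
  by rewrite dotC -quad_dot.
by apply: mean_ge0 => t; rewrite dotC -quad_dot.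
Qed.

(** Both centered summands are nonnegative, so both vanish: the second kills the mean, the first
    then the fluctuation almost surely. *)
Lemma bil_eq0 p (M Mb : 'M[R]_p) X : posdef M -> posdef (M + Mb) -> L2 P X ->
  bil M Mb X X = 0 -> {ae P, forall t, X t = 0}.
Proof.
move=> pM pMb XL; rewrite bil_centered// => B0.
have cX := L2_centered XL.
have c0 t : 0 <= dot (M *m centered P X t) (centered P X t).
  by rewrite dotC -quad_dot; exact: posdef_psd.
have m0 : 0 <= ip P (fun t => M *m centered P X t) (centered P X).
  exact: mean_ge0.
have e0 : 0 <= dot ((M + Mb) *m Evec P X) (Evec P X).
  by rewrite dotC -quad_dot; exact: posdef_psd.
have EX0 : Evec P X = 0.
  apply/eqP; apply: contraT => /pMb; rewrite quad_dot dotC; lra.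
have : {ae P, forall t, dot (M *m centered P X t) (centered P X t) = 0}.
  apply: mean_eq0_ae => //; first by apply: intg_dot => //; exact: L2mx.
  by rewrite -/(ip P _ _); lra.
apply: filterS => t; rewrite dotC -quad_dot => q0.
have : centered P X t = 0.
  by apply/eqP; apply: contraT => /pM; rewrite q0 ltxx.
by rewrite /centered EX0 subr0.
Qed.

End MeanFieldForm.

(** * One time step of the dynamics, the feedback law and the costate *)

Section Dynamics.
Context (R : realType) (d : measure_display) (T : measurableType d).
Variables (P : probability T R) (n m : nat) (c : lq_coeffs R n m).

(** Convertible with the recursive clause of [state_x], but open to any state and control, so that
    it also propagates differences of trajectories. *)
Definition step_x k (w : T -> R) (x : T -> 'cV[R]_n) (u : T -> 'cV[R]_m) t :=
  (A_ c k *m x t + Ab_ c k *m Evec P x + B_ c k *m u t + Bb_ c k *m Evec P u)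
  + w t *: (C_ c k *m x t + Cb_ c k *m Evec P x
            + D_ c k *m u t + Db_ c k *m Evec P u).

Definition step_y k (v : T -> R) (y : T -> 'cV[R]_n) t :=
  (F_ c k *m y t + Fb_ c k *m Evec P y)
  + v t *: (G_ c k *m y t + Gb_ c k *m Evec P y).

Definition law k (q : riccati R n) (x y : T -> 'cV[R]_n) t : 'cV[R]_m :=
  - (invmx (W1 c k q) *m (H1 c k q)^T *m (x t - Evec P x))
  - invmx (W2 c k q) *m (H2 c k q)^T *m Evec P x
  - invmx (W1 c k q) *m (H3 c k q)^T *m (y t - Evec P y)
  - invmx (W2 c k q) *m (H4 c k q)^T *m Evec P y.

(** Half the L2 gradient in [x] of the quadratic value function; the cross matrices are transposed
    because they pair [y] on the left with [x] on the right. *)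
Definition costate (q : riccati R n) (x y : T -> 'cV[R]_n) t :=
  (Sx q *m centered P x t + (Sxy q)^T *m centered P y t)
  + (Tx q *m Evec P x + (Txy q)^T *m Evec P y).

Lemma step_xB k w x x' u u' : L2 P x -> L2 P x' -> L2 P u -> L2 P u' ->
  (fun t => step_x k w x' u' t - step_x k w x u t) =
  step_x k w (fun t => x' t - x t) (fun t => u' t - u t).
Proof.
move=> xL x'L uL u'L; apply/funext => t; rewrite /step_x !EvecB// !mulmxBr.
by apply/dot_inj => z; rewrite !(dotDr, dotNr, dotZr); ring.
Qed.

Section Step.
Variables (gen : set (set T)) (k : nat) (w v : T -> R) (q : riccati R n).
Hypothesis gen_sub : <<s gen >> `<=` @measurable _ T.
Hypotheses (mw : measurable_fun [set: T] w) (mv : measurable_fun [set: T] v).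
Hypotheses (w0 : cond_expectation P <<s gen >> w (fun=> 0))
           (v0 : cond_expectation P <<s gen >> v (fun=> 0))
           (w2 : cond_expectation P <<s gen >> (fun t => w t ^+ 2) (fun=> 1))
           (v2 : cond_expectation P <<s gen >> (fun t => v t ^+ 2) (fun=> 1))
           (wv : cond_expectation P <<s gen >> (fun t => w t * v t)
                  (fun=> rho_ c)).
Local Notation L2G := (L2wrt P gen).

(** The noise term has mean zero as a whole, so the current means survive in the next fluctuation as
    part of the coefficient of [w]. *)
Lemma centered_step_x x u : L2G x -> L2G u ->
  (Evec P (step_x k w x u) =
     (A_ c k + Ab_ c k) *m Evec P x + (B_ c k + Bb_ c k) *m Evec P u) /\
  (forall t, centered P (step_x k w x u) t =
     A_ c k *m centered P x t + B_ c k *m centered P u t +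
     w t *: (C_ c k *m centered P x t + D_ c k *m centered P u t +
       ((C_ c k + Cb_ c k) *m Evec P x + (D_ c k + Db_ c k) *m Evec P u))).
Proof.
move=> xG uG; have [_ xL] := xG; have [_ uL] := uG.
have E : Evec P (step_x k w x u) =
     (A_ c k + Ab_ c k) *m Evec P x + (B_ c k + Bb_ c k) *m Evec P u.
  have zG : L2G (fun t => C_ c k *m x t + Cb_ c k *m Evec P x
            + D_ c k *m u t + Db_ c k *m Evec P u).
    by do ![apply: L2wrtD|apply: L2wrt_mx|exact: L2wrt_cst|done].
  rewrite EvecD; [|by do ![apply: L2D|apply: L2mx|exact: L2cst|done]
                  |exact: L2_noise zG].
  rewrite (Evec_noise gen_sub w0 zG); last exact: L2_noise zG.
  rewrite !EvecD ?Evec_mulmx ?Evec_cst//;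
    try by do ![apply: L2D|apply: L2mx|exact: L2cst|done].
  by rewrite addr0; apply/dot_inj => z; rewrite !mulmxDl !dotDr; ring.
split=> // t; rewrite /centered E /step_x; apply/dot_inj => z.
by rewrite !(mulmxDl, mulmxBr) !(dotDr, dotNr, dotZr); ring.
Qed.

Lemma centered_step_y y : L2G y ->
  (Evec P (step_y k v y) = (F_ c k + Fb_ c k) *m Evec P y) /\
  (forall t, centered P (step_y k v y) t =
     F_ c k *m centered P y t +
     v t *: (G_ c k *m centered P y t + (G_ c k + Gb_ c k) *m Evec P y)).
Proof.
move=> yG; have [_ yL] := yG.
have E : Evec P (step_y k v y) = (F_ c k + Fb_ c k) *m Evec P y.
  have zG : L2G (fun t => G_ c k *m y t + Gb_ c k *m Evec P y).
    by do ![apply: L2wrtD|apply: L2wrt_mx|exact: L2wrt_cst|done].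
  rewrite EvecD; [|by do ![apply: L2D|apply: L2mx|exact: L2cst|done]
                  |exact: L2_noise zG].
  rewrite (Evec_noise gen_sub v0 zG); last exact: L2_noise zG.
  rewrite !EvecD ?Evec_mulmx ?Evec_cst//;
    try by do ![apply: L2D|apply: L2mx|exact: L2cst|done].
  by rewrite addr0; apply/dot_inj => z; rewrite !mulmxDl !dotDr; ring.
split=> // t; rewrite /centered E /step_y; apply/dot_inj => z.
by rewrite !(mulmxDl, mulmxBr) !(dotDr, dotNr, dotZr); ring.
Qed.

Lemma L2wrt_law x y : L2G x -> L2G y -> L2G (law k q x y).
Proof.
move=> xG yG.
by do ![apply: L2wrtD|apply: L2wrtN|apply: L2wrt_mx|exact: L2wrt_cst|done].
Qed.

(** The gains with [W2] act on the means only and those with [W1] on the fluctuations only, which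
    matches the two instances of the template. *)
Lemma centered_law x y : L2G x -> L2G y ->
  (Evec P (law k q x y) =
     - (invmx (W2 c k q) *m (H2 c k q)^T *m Evec P x)
     - invmx (W2 c k q) *m (H4 c k q)^T *m Evec P y) /\
  (forall t, centered P (law k q x y) t =
     - (invmx (W1 c k q) *m (H1 c k q)^T *m centered P x t)
     - invmx (W1 c k q) *m (H3 c k q)^T *m centered P y t).
Proof.
move=> [_ xL] [_ yL].
have E : Evec P (law k q x y) =
     - (invmx (W2 c k q) *m (H2 c k q)^T *m Evec P x)
     - invmx (W2 c k q) *m (H4 c k q)^T *m Evec P y.
  have cx := L2_centered xL; have cy := L2_centered yL.
  rewrite /law !EvecB ?EvecN ?Evec_mulmx ?Evec_cst//;
    try by do ![apply: L2D|apply: L2N|apply: L2mx|exact: L2cst|done].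
  rewrite -!/(centered P _) !Evec_centered// !mulmx0.
  by rewrite oppr0 add0r addr0.
split=> // t; rewrite /centered E /law; apply/dot_inj => z.
by rewrite !(dotDr, dotNr, dotZr); ring.
Qed.

Lemma ip_mulmx2 p1 p2 r (M1 : 'M[R]_(p1, r)) (M2 : 'M[R]_(p2, r)) X1 X2 Z :
  L2 P X1 -> L2 P X2 -> L2 P Z ->
  ip P X1 (fun t => M1 *m Z t) + ip P X2 (fun t => M2 *m Z t) =
  ip P (fun t => M1^T *m X1 t + M2^T *m X2 t) Z.
Proof.
move=> L1 L2' LZ; rewrite !ip_mulmxr -ipDl//; exact: L2mx.
Qed.

(** Transposes the perturbed step, so that the coefficients of state and control perturbations,
    centered and mean, appear in the form treated by the stationarity lemmas. *)
Lemma pairing_adjoint p r (A A' C C' : 'M[R]_(n, p)) (B B' D D' : 'M[R]_(n, r))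
    a b am bm (z : T -> 'cV[R]_p) (s : T -> 'cV[R]_r) zm sm :
  L2 P a -> L2 P b -> L2 P z -> L2 P s ->
  ip P a (fun t => A *m z t + B *m s t) + dot am (A' *m zm + B' *m sm) +
  (ip P b (fun t => C *m z t + D *m s t) + dot bm (C' *m zm + D' *m sm)) =
  ip P (fun t => A^T *m a t + C^T *m b t) z +
  ip P (fun t => B^T *m a t + D^T *m b t) s +
  (dot (A'^T *m am + C'^T *m bm) zm + dot (B'^T *m am + D'^T *m bm) sm).
Proof.
move=> aL bL zL sL; have Az := L2mx A zL; have Bs := L2mx B sL.
have Cz := L2mx C zL; have Ds := L2mx D sL.
rewrite -!ip_mulmx2// (ipDr Az Bs aL) (ipDr Cz Ds bL) !dotDl !dotDr !dot_mulmxr.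
ring.
Qed.

Hypotheses (symQ : symmetric_mx (Q_ c k)) (symQb : symmetric_mx (Qb_ c k)).
Hypotheses (symR : symmetric_mx (R_ c k)) (symRb : symmetric_mx (Rb_ c k)).
Hypotheses (posR : posdef (R_ c k)) (posRb : posdef (R_ c k + Rb_ c k)).
Hypotheses (symS : symmetric_mx (Sx q)) (symT : symmetric_mx (Tx q)).
Hypotheses (psdS : psd (Sx q)) (psdT : psd (Tx q)).

(** The summand of the telescoping sum. Averaging out the noise leaves the predictions [a] and [b]
    of the next costate; after transposition, the adjoint equation yields the [dx] terms and the
    first-order condition the [du] terms. *)
Lemma costate_step x y dx du : L2G x -> L2G y -> L2G dx -> L2G du ->
  ip P (costate q (step_x k w x (law k q x y)) (step_y k v y))
       (step_x k w dx du) =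
  ip P (costate (riccati_step c k q) x y) dx
  - bil P (Q_ c k) (Qb_ c k) (fun t => x t - y t) dx
  - bil P (R_ c k) (Rb_ c k) (law k q x y) du.
Proof.
move=> xG yG dxG duG; pose u := law k q x y.
have uG : L2G u by exact: L2wrt_law.
have [[Eu cu] [Ex cx] [Ey cy] [Edx cdx]] :=
  And4 (centered_law xG yG) (centered_step_x xG uG) (centered_step_y yG)
       (centered_step_x dxG duG).
rewrite -/u in Eu cu *.
set X := Evec P x in Ex cx; set Y := Evec P y in Ey cy.
set U := Evec P u in Ex cx; set dX := Evec P dx in Edx cdx.
set dU := Evec P du in Edx cdx.
pose xi := centered P x; pose eta := centered P y; pose mu := centered P u.
pose dxi := centered P dx; pose dmu := centered P du.
have zm p (Z : T -> 'cV[R]_p) : L2G Z -> L2G (centered P Z) /\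
    (L2 P (centered P Z) /\ Evec P (centered P Z) = 0).
  move=> ZG; split; first exact: L2wrt_centered.
  by split; [apply: L2_centered; case: ZG|apply: Evec_centered; case: ZG].
have [xiG [xiL xi0]] := zm _ _ xG; have [etaG [etaL eta0]] := zm _ _ yG.
have [muG [muL mu0]] := zm _ _ uG; have [dxiG [dxiL dxi0]] := zm _ _ dxG.
have [dmuG [dmuL dmu0]] := zm _ _ duG.
rewrite -/xi in xiG xiL xi0 cx cu; rewrite -/eta in etaG etaL eta0 cy cu.
rewrite -/mu in muG muL mu0 cx cu; rewrite -/dxi in dxiG dxiL dxi0 cdx.
rewrite -/dmu in dmuG dmuL dmu0 cdx.
pose ac t := Sx q *m (A_ c k *m xi t + B_ c k *m mu t)
             + (Sxy q)^T *m (F_ c k *m eta t).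
pose am := Tx q *m ((A_ c k + Ab_ c k) *m X + (B_ c k + Bb_ c k) *m U)
           + (Txy q)^T *m ((F_ c k + Fb_ c k) *m Y).
pose bc t := Sx q *m (C_ c k *m xi t + D_ c k *m mu t)
             + rho_ c *: ((Sxy q)^T *m (G_ c k *m eta t)).
pose bm := Sx q *m ((C_ c k + Cb_ c k) *m X + (D_ c k + Db_ c k) *m U)
           + rho_ c *: ((Sxy q)^T *m ((G_ c k + Gb_ c k) *m Y)).
pose da t := A_ c k *m dxi t + B_ c k *m dmu t.
pose dam := (A_ c k + Ab_ c k) *m dX + (B_ c k + Bb_ c k) *m dU.
pose db t := C_ c k *m dxi t + D_ c k *m dmu t.
pose dbm := (C_ c k + Cb_ c k) *m dX + (D_ c k + Db_ c k) *m dU.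
(* [b] and [g] are the raw coefficients of [w] and [v] in the next costate; [b + rho_ c *: g]
   regroups into the fluctuation [bc] and the mean [bm]. *)
pose b t := Sx q *m ((C_ c k *m xi t + D_ c k *m mu t)
            + ((C_ c k + Cb_ c k) *m X + (D_ c k + Db_ c k) *m U)).
pose g t := (Sxy q)^T *m (G_ c k *m eta t + (G_ c k + Gb_ c k) *m Y).
have -> : costate q (step_x k w x u) (step_y k v y) =
    fun t => (ac t + am) + w t *: b t + v t *: g t.
  apply/funext => t; rewrite /costate Ex Ey cx cy /ac /am /b /g.
  apply/dot_inj => z.
  by rewrite !mulmxDr -!scalemxAr !(mulmxDr, dotDr, dotZr); ring.
have -> : step_x k w dx du = fun t => (da t + dam) + w t *: (db t + dbm).
  apply/funext => t.
  rewrite -[LHS](subrK (Evec P (step_x k w dx du))).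
  by rewrite -/(centered P _ t) Edx cdx addrAC.
have rG p (Z : T -> 'cV[R]_p) : L2G Z -> L2G (fun t => rho_ c *: Z t).
  move=> /(L2wrt_mx (rho_ c)%:M).
  by under eq_fun do rewrite mul_scalar_mx.
have rE p (Z : T -> 'cV[R]_p) : L2 P Z -> Evec P Z = 0 ->
    Evec P (fun t => rho_ c *: Z t) = 0.
  move=> ZL Z0; have := Evec_mulmx (rho_ c)%:M ZL.
  by under eq_fun do rewrite mul_scalar_mx; rewrite Z0 mulmx0.
have acG : L2G ac by do ![assumption|apply: L2wrtD|apply: L2wrt_mx].
have bcG : L2G bc.
  apply: L2wrtD; first by do ![assumption|apply: L2wrtD|apply: L2wrt_mx].
  by apply: (rG); do 2 apply: L2wrt_mx.
have daG : L2G da by do ![assumption|apply: L2wrtD|apply: L2wrt_mx].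
have dbG : L2G db by do ![assumption|apply: L2wrtD|apply: L2wrt_mx].
have E0 p (M1 : 'M[R]_(p, n)) (M2 : 'M[R]_(p, m)) Z1 Z2 :
    L2G Z1 -> L2G Z2 -> Evec P Z1 = 0 -> Evec P Z2 = 0 ->
    Evec P (fun t => M1 *m Z1 t + M2 *m Z2 t) = 0.
  move=> [_ Z1L] [_ Z2L] Z10 Z20; rewrite EvecD; try exact: L2mx.
  by rewrite !Evec_mulmx// Z10 Z20 !mulmx0 addr0.
have E0' p r (M : 'M[R]_(p, r)) Z : L2G Z -> Evec P Z = 0 ->
    Evec P (fun t => M *m Z t) = 0.
  by move=> [_ ZL] Z0; rewrite Evec_mulmx// Z0 mulmx0.
have ED p (Z1 Z2 : T -> 'cV[R]_p) : L2G Z1 -> L2G Z2 ->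
    Evec P Z1 = 0 -> Evec P Z2 = 0 ->
    Evec P (fun t => Z1 t + Z2 t) = 0.
  by move=> [_ Z1L] [_ Z2L] Z10 Z20; rewrite EvecD// Z10 Z20 addr0.
have da0 : Evec P da = 0 by exact: E0.
have db0 : Evec P db = 0 by exact: E0.
have ac0 : Evec P ac = 0.
  apply: (ED); [by do ![assumption|apply: L2wrtD|apply: L2wrt_mx]| | |].
  - by do 2 apply: L2wrt_mx.
  - apply: (E0'); last exact: E0.
    by do ![assumption|apply: L2wrtD|apply: L2wrt_mx].
  - by apply: (E0'); [exact: L2wrt_mx|exact: E0'].
have bc0 : Evec P bc = 0.
  apply: (ED); first by do ![assumption|apply: L2wrtD|apply: L2wrt_mx].
  - by apply: (rG); do 2 apply: L2wrt_mx.
  - apply: (E0'); last exact: E0.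
    by do ![assumption|apply: L2wrtD|apply: L2wrt_mx].
  - apply: (rE); first by do 2 apply: L2mx.
    by apply: (E0'); [exact: L2wrt_mx|exact: E0'].
have [_ acL] := acG; have [_ bcL] := bcG.
have [_ daL] := daG; have [_ dbL] := dbG.
rewrite (ip_noise gen_sub mw mv w0 v0 w2 v2 wv);
  try by do ![assumption|apply: L2wrtD|apply: L2wrt_mx|exact: L2wrt_cst].
have -> : (fun t => b t + rho_ c *: g t) = fun t => bc t + bm.
  apply/funext => t; rewrite /b /g /bc /bm; apply/dot_inj => z.
  by rewrite !mulmxDr !scalerDr !dotDr; ring.
rewrite !ip_addcst//.
rewrite pairing_adjoint//.
have [_ uL] := uG; have [_ duL] := duG; have [_ xL] := xG.
have [_ yL] := yG; have [_ dxL] := dxG.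
rewrite -/u (bil_centered _ _ uL duL) (bil_centered _ _ (L2B xL yL) dxL).
rewrite (EvecB xL yL) -/mu -/dmu -/dxi -/U -/dU -/dX -/X -/Y.
have -> : centered P (fun t => x t - y t) = fun t => xi t - eta t.
  apply/funext => t; rewrite /centered (EvecB xL yL) /xi /eta /centered.
  by rewrite !opprD !opprK addrACA.
have -> : ip P (costate (riccati_step c k q) x y) dx =
    ip P (fun t => Sx (riccati_step c k q) *m xi t +
                   (Sxy (riccati_step c k q))^T *m eta t) dxi +
    dot (Tx (riccati_step c k q) *m X + (Txy (riccati_step c k q))^T *m Y) dX.
  rewrite -ip_addcst//.
  - by congr ip; apply/funext => t; rewrite subrK.
  - by apply: L2D; exact: L2mx.
  - by rewrite EvecD ?Evec_mulmx ?xi0 ?eta0 ?mulmx0 ?addr0//; exact: L2mx.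
have -> : (fun t => (B_ c k)^T *m ac t + (D_ c k)^T *m bc t) =
    fun t => - (R_ c k *m mu t).
  apply/funext => t; rewrite /ac /bc cu.
  exact: stationarity_control.
have -> : (fun t => (A_ c k)^T *m ac t + (C_ c k)^T *m bc t) =
    fun t => Sx (riccati_step c k q) *m xi t +
      (Sxy (riccati_step c k q))^T *m eta t - Q_ c k *m (xi t - eta t).
  apply/funext => t; rewrite /ac /bc cu.
  exact: stationarity_state.
have symRR := symmetric_mxD symR symRb.
have symQQ := symmetric_mxD symQ symQb.
have -> : (B_ c k + Bb_ c k)^T *m am + (D_ c k + Db_ c k)^T *m bm =
    - ((R_ c k + Rb_ c k) *m U).
  by rewrite /am /bm /U Eu; exact: stationarity_control.
have -> : (A_ c k + Ab_ c k)^T *m am + (C_ c k + Cb_ c k)^T *m bm =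
    Tx (riccati_step c k q) *m X + (Txy (riccati_step c k q))^T *m Y
    - (Q_ c k + Qb_ c k) *m (X - Y).
  (* The template expects its state weight as the single matrix [Q_ c k + Qb_ c k]. *)
  have -> : Txy (riccati_step c k q) = - (Q_ c k + Qb_ c k)
      + (F_ c k + Fb_ c k)^T *m Txy q *m (A_ c k + Ab_ c k)
      + rho_ c *: ((G_ c k + Gb_ c k)^T *m Sxy q *m (C_ c k + Cb_ c k))
      - H4 c k q *m invmx (W2 c k q) *m (H2 c k q)^T by rewrite opprD.
  by rewrite /am /bm /U Eu; exact: stationarity_state.
rewrite ipBl ?ipNl ?dotDl ?dotNl//;
  try by do ![assumption|apply: L2B|apply: L2D|apply: L2mx].
by ring.
Qed.


End Step.
End Dynamics.

(** * Optimality of the feedback control *)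

Section RiccatiSolution.
Context (R : realType) (n m N : nat) (c : lq_coeffs R n m).
Hypotheses (symQ : forall k, (k <= N)%N ->
              symmetric_mx (Q_ c k) /\ symmetric_mx (Qb_ c k))
           (symR : forall k, (k < N)%N ->
              symmetric_mx (R_ c k) /\ symmetric_mx (Rb_ c k))
           (psdQ : forall k, (k <= N)%N ->
              psd (Q_ c k) /\ psd (Q_ c k + Qb_ c k))
           (posR : forall k, (k < N)%N ->
              posdef (R_ c k) /\ posdef (R_ c k + Rb_ c k)).

(** Backward induction, run on the distance to [N]. Symmetry and positivity travel together, because
    positivity at the next time makes [W1] and [W2] definite, hence invertible. *)
Lemma riccati_sol_sym_psd k : (k <= N)%N ->
  [/\ symmetric_mx (Sx (riccati_sol c N k)),
      symmetric_mx (Tx (riccati_sol c N k)),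
      psd (Sx (riccati_sol c N k)) & psd (Tx (riccati_sol c N k))].
Proof.
move=> kN; rewrite -(subKn kN); elim: (N - k)%N (leq_subr k N) => [_|j IHj jN].
  rewrite subn0 riccati_sol_end; have [sQ sQb] := symQ (leqnn N).
  by have [pQ pQb] := psdQ (leqnn N); split=> //=; exact: symmetric_mxD.
have [sS sT pS pT] := IHj (ltnW jN).
have lN : (N - j.+1 < N)%N by rewrite ltn_subrL (leq_ltn_trans _ jN).
have [sQ sQb] := symQ (ltnW lN); have [pQ pQb] := psdQ (ltnW lN).
have [sR sRb] := symR lN; have [pR pRb] := posR lN.
rewrite riccati_sol_step// subnSK//; split=> /=.
- exact: sym_riccati_step.
- by apply: sym_riccati_step => //; exact: symmetric_mxD.
- exact: psd_riccati_step.
- exact: psd_riccati_step.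
Qed.

(** Ensures that [invmx] is a true inverse; on a singular matrix it returns its argument. *)
Lemma riccati_sol_unit k : (k < N)%N ->
  W1 c k (riccati_sol c N k.+1) \in unitmx /\
  W2 c k (riccati_sol c N k.+1) \in unitmx.
Proof.
move=> kN; have [_ _ pS pT] := riccati_sol_sym_psd kN.
have [pR pRb] := posR kN.
by split; apply/posdef_unitmx; apply: posdef_W.
Qed.

End RiccatiSolution.

(** * Adaptedness, the closed loop and the cost *)

Section Filtration.
Context (R : realType) (d : measure_display) (T : measurableType d).
Variables (P : probability T R) (n m N : nat) (c : lq_coeffs R n m).
Variables (zx zy : T -> 'cV[R]_n) (w v : nat -> {RV P >-> R}).
Hypotheses (zx2 : square_integrable P zx) (zy2 : square_integrable P zy).
Hypothesis noise : forall k, (k < N)%N ->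
  let Fk := info zx zy w v k in
  [/\ cond_expectation P Fk (w k) (fun=> 0),
      cond_expectation P Fk (v k) (fun=> 0),
      cond_expectation P Fk (fun t => w k t ^+ 2) (fun=> 1),
      cond_expectation P Fk (fun t => v k t ^+ 2) (fun=> 1) &
      cond_expectation P Fk (fun t => w k t * v k t) (fun=> rho_ c)].

(** The generating family inside [info], named because [L2wrt] takes a generator. *)
Definition info_gen k : set (set T) :=
  [set S | (exists i,
              preimage_set_system [set: T] (fun t => zx t i 0)
                (@measurable _ R) S \/
              preimage_set_system [set: T] (fun t => zy t i 0)
                (@measurable _ R) S) \/
           (exists2 l, (l < k)%N &
              preimage_set_system [set: T] (w l) (@measurable _ R) S \/
              preimage_set_system [set: T] (v l) (@measurable _ R) S)].

Local Notation adapted k := (L2wrt P (info_gen k)).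

Lemma info_sub k : <<s info_gen k >> `<=` @measurable _ T.
Proof.
apply: smallest_sub; first exact: sigma_algebra_measurable.
have pre (f : T -> R) : measurable_fun [set: T] f ->
    preimage_set_system [set: T] f measurable `<=` @measurable _ T.
  by move=> mf S [B mB <-]; exact: mf.
move=> S [[i [|]]|[l _ [|]]]; apply: pre => //.
- exact: zx2.1.
- exact: zy2.1.
Qed.

Lemma info_mono k l : (k <= l)%N -> <<s info_gen k >> `<=` <<s info_gen l >>.
Proof.
move=> kl; apply: sub_sigma_algebra2 => S [?|[j jk ?]]; [by left|right].
by exists j => //; exact: leq_trans kl.
Qed.

Lemma adapted_mono k l p (X : T -> 'cV[R]_p) :
  (k <= l)%N -> adapted k X -> adapted l X.
Proof.
by move=> kl [mX XL]; split=> // i S /(mX i) /(info_mono kl).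
Qed.

(** The noise of index k becomes known only at time k + 1, hence the shift. *)
Lemma adapted_noise k p (s : nat -> {RV P >-> R}) (X : T -> 'cV[R]_p) :
  (k < N)%N -> s = w \/ s = v ->
  adapted k X -> adapted k.+1 (fun t => s k t *: X t).
Proof.
move=> kN swv XG; have [mX _] := adapted_mono (leqnSn k) XG; split.
  move=> i; under eq_fun do rewrite mxE.
  apply/measurable_wrt_measurable_fun; apply: measurable_funM.
    apply/measurable_wrt_measurable_fun => S sS; apply: sub_sigma_algebra.
    by right; exists k => //; case: swv => <-; [left|right].
  exact/measurable_wrt_measurable_fun.
have [_ _ w2 v2 _] := noise kN.
by case: swv => ->; apply: (L2_noise (@info_sub k)) XG => //;
  exact: measurable_funPT.
Qed.

Lemma adapted_step_x k (x : T -> 'cV[R]_n) (u : T -> 'cV[R]_m) : (k < N)%N ->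
  adapted k x -> adapted k u -> adapted k.+1 (step_x P c k (w k) x u).
Proof.
move=> kN xG uG; apply: L2wrtD.
  apply: (adapted_mono (leqnSn k)).
  by do ![assumption|apply: L2wrtD|apply: L2wrt_mx|exact: L2wrt_cst].
apply: adapted_noise => //; first by left.
by do ![assumption|apply: L2wrtD|apply: L2wrt_mx|exact: L2wrt_cst].
Qed.

Lemma adapted_step_y k (y : T -> 'cV[R]_n) : (k < N)%N ->
  adapted k y -> adapted k.+1 (step_y P c k (v k) y).
Proof.
move=> kN yG; apply: L2wrtD.
  apply: (adapted_mono (leqnSn k)).
  by do ![assumption|apply: L2wrtD|apply: L2wrt_mx|exact: L2wrt_cst].
apply: adapted_noise => //; first by right.
by do ![assumption|apply: L2wrtD|apply: L2wrt_mx|exact: L2wrt_cst].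
Qed.

Lemma adapted_zx : adapted 0 zx.
Proof.
split; last exact/square_integrableP.
by move=> i S zS; apply: sub_sigma_algebra; left; exists i; left.
Qed.

Lemma adapted_zy : adapted 0 zy.
Proof.
split; last exact/square_integrableP.
by move=> i S zS; apply: sub_sigma_algebra; left; exists i; right.
Qed.

Lemma adapted_state_x (u : nat -> T -> 'cV[R]_m) k :
  (k <= N)%N -> (forall l, (l < k)%N -> adapted l (u l)) ->
  adapted k (state_x P c zx w u k).
Proof.
elim: k => [|k IHk] kN uG; first exact: adapted_zx.
apply: adapted_step_x => //; last exact: uG.
by apply: IHk => [|l lk]; [exact: ltnW|exact/uG/ltnW].
Qed.

Lemma adapted_state_y k : (k <= N)%N -> adapted k (state_y P c zy v k).
Proof.
elim: k => [|k IHk] kN; first exact: adapted_zy.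
by apply: adapted_step_y => //; exact/IHk/ltnW.
Qed.

Lemma admissibleP (u : nat -> T -> 'cV[R]_m) :
  admissible P N zx zy w v u <-> forall k, (k < N)%N -> adapted k (u k).
Proof.
by split=> uA k /uA [mu uL]; split=> //; apply/square_integrableP.
Qed.

(** The feedback law refers to the trajectory of its own control. Substituting the law into the
    dynamics breaks this circle: the closed-loop state comes first, the control is read off from
    it. *)
Fixpoint opt_x k : T -> 'cV[R]_n :=
  if k is l.+1 then
    step_x P c l (w l) (opt_x l)
      (law P c l (riccati_sol c N l.+1) (opt_x l) (state_y P c zy v l))
  else zx.

Definition opt_u k : T -> 'cV[R]_m :=
  law P c k (riccati_sol c N k.+1) (opt_x k) (state_y P c zy v k).

Lemma state_x_opt k : state_x P c zx w opt_u k = opt_x k.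
Proof. by elim: k => //= k IHk; rewrite -/(state_x _ _ _ _ _) IHk. Qed.

Lemma opt_u_law k : opt_u k =
  law P c k (riccati_sol c N k.+1)
    (state_x P c zx w opt_u k) (state_y P c zy v k).
Proof. by rewrite state_x_opt. Qed.

Lemma opt_u_feedback : feedback_control P N c zx zy w v opt_u.
Proof. by move=> k kN t /=; rewrite opt_u_law. Qed.

(** Strong induction, since the state at time k involves all earlier controls. *)
Lemma adapted_opt_u k : (k < N)%N -> adapted k (opt_u k).
Proof.
elim/ltn_ind: k => k IHk kN; rewrite opt_u_law; apply: L2wrt_law.
  apply: adapted_state_x => [|l lk]; first exact: ltnW.
  by apply: IHk => //; exact: ltn_trans kN.
exact/adapted_state_y/ltnW.
Qed.

Definition tracking_error (u : nat -> T -> 'cV[R]_m) k t : 'cV[R]_n :=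
  state_x P c zx w u k t - state_y P c zy v k t.

(** The finite value of [cost] for adapted controls, in terms of [bil], so that expansion is real
    arithmetic. *)
Definition real_cost (u : nat -> T -> 'cV[R]_m) : R :=
  \sum_(k < N)
    (bil P (Q_ c k) (Qb_ c k) (tracking_error u k) (tracking_error u k)
     + bil P (R_ c k) (Rb_ c k) (u k) (u k))
  + bil P (Q_ c N) (Qb_ c N) (tracking_error u N) (tracking_error u N).

Lemma L2_tracking_error u k : (forall l, (l < N)%N -> adapted l (u l)) ->
  (k <= N)%N -> L2 P (tracking_error u k).
Proof.
move=> uG kN; apply: L2B.
  suff [] : adapted k (state_x P c zx w u k) by [].
  by apply: adapted_state_x => // l lk; apply: uG; exact: leq_trans kN.
by have [] := adapted_state_y kN.
Qed.

Lemma intg_quad p (M : 'M[R]_p) (X : T -> 'cV[R]_p) :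
  L2 P X -> intg P (fun t => quad M (X t)).
Proof.
move=> XL; under eq_fun do rewrite quad_dot.
by apply: intg_dot => //; exact: L2mx.
Qed.

Lemma mean_quad p (M : 'M[R]_p) (X : T -> 'cV[R]_p) :
  mean P (fun t => quad M (X t)) = ip P (fun t => M *m X t) X.
Proof. by congr mean; apply/funext => t; rewrite quad_dot dotC. Qed.

Lemma cost_real u : (forall l, (l < N)%N -> adapted l (u l)) ->
  cost P N c zx zy w v u = (real_cost u)%:E.
Proof.
move=> uG; rewrite /cost /= -!/(tracking_error u _).
have eN := L2_tracking_error uG (leqnn N).
rewrite expectation_intg; last exact: intg_quad.
rewrite (eq_bigr (fun k : 'I_N =>
  (bil P (Q_ c k) (Qb_ c k) (tracking_error u k) (tracking_error u k)
   + bil P (R_ c k) (Rb_ c k) (u k) (u k))%:E)); last first.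
  move=> k _; have eL := L2_tracking_error uG (ltnW (ltn_ord k)).
  have [_ uL] := uG _ (ltn_ord k).
  have i1 := intg_quad (Q_ c k) eL; have i2 := intg_quad (R_ c k) uL.
  have i3 := intg_cst P (quad (Qb_ c k) (Evec P (tracking_error u k))).
  have i4 := intg_cst P (quad (Rb_ c k) (Evec P (u k))).
  rewrite expectation_intg; last exact: intgD (intgD (intgD i1 i2) i3) i4.
  rewrite (meanD (intgD (intgD i1 i2) i3) i4) (meanD (intgD i1 i2) i3).
  rewrite (meanD i1 i2).
  rewrite !mean_cst !mean_quad /bil !(dotC _ (Evec _ _)) -!quad_dot.
  by congr EFin; ring.
rewrite sumEFin -!EFinD /real_cost; congr EFin; rewrite -addrA; congr (_ + _).
by rewrite mean_quad /bil (dotC _ (Evec _ _)) -quad_dot.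
Qed.

Hypotheses (symQ : forall k, (k <= N)%N ->
              symmetric_mx (Q_ c k) /\ symmetric_mx (Qb_ c k))
           (symR : forall k, (k < N)%N ->
              symmetric_mx (R_ c k) /\ symmetric_mx (Rb_ c k))
           (psdQ : forall k, (k <= N)%N ->
              psd (Q_ c k) /\ psd (Q_ c k + Qb_ c k))
           (posR : forall k, (k < N)%N ->
              posdef (R_ c k) /\ posdef (R_ c k + Rb_ c k)).

(** * Variation around the feedback control *)

Section Perturbation.
Variable u : nat -> T -> 'cV[R]_m.
Hypothesis uG : forall k, (k < N)%N -> adapted k (u k).

Definition du k t : 'cV[R]_m := u k t - opt_u k t.
Definition dx k t : 'cV[R]_n :=
  state_x P c zx w u k t - state_x P c zx w opt_u k t.

Lemma adapted_du k : (k < N)%N -> adapted k (du k).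
Proof. by move=> kN; apply: L2wrtB; [exact: uG|exact: adapted_opt_u]. Qed.

Let L2u k : (k < N)%N -> L2 P (u k).
Proof. by move=> /uG []. Qed.

Let L2opt k : (k < N)%N -> L2 P (opt_u k).
Proof. by move=> /adapted_opt_u []. Qed.

Let adapted_x k : (k <= N)%N -> adapted k (state_x P c zx w u k).
Proof.
by move=> kN; apply: adapted_state_x => // l lk; apply: uG; exact: leq_trans kN.
Qed.

Let adapted_opt k : (k <= N)%N -> adapted k (state_x P c zx w opt_u k).
Proof.
move=> kN; apply: adapted_state_x => // l lk; apply: adapted_opt_u.
exact: leq_trans kN.
Qed.

Lemma adapted_dx k : (k <= N)%N -> adapted k (dx k).
Proof. by move=> kN; apply: L2wrtB; [exact: adapted_x|exact: adapted_opt]. Qed.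

Lemma dx_step k : (k < N)%N -> dx k.+1 = step_x P c k (w k) (dx k) (du k).
Proof.
move=> kN; rewrite -step_xB//; try exact: L2u; try exact: L2opt.
- by have [] := adapted_opt (ltnW kN).
- by have [] := adapted_x (ltnW kN).
Qed.

Let pairing k : R :=
  ip P (costate P (riccati_sol c N k) (state_x P c zx w opt_u k)
          (state_y P c zy v k)) (dx k).

Lemma first_variation :
  \sum_(k < N) (bil P (Q_ c k) (Qb_ c k) (tracking_error opt_u k) (dx k)
                + bil P (R_ c k) (Rb_ c k) (opt_u k) (du k))
  + bil P (Q_ c N) (Qb_ c N) (tracking_error opt_u N) (dx N) = 0.
Proof.
have step (k : 'I_N) :
    bil P (Q_ c k) (Qb_ c k) (tracking_error opt_u k) (dx k)
    + bil P (R_ c k) (Rb_ c k) (opt_u k) (du k) = pairing k - pairing k.+1.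
  have kN := ltn_ord k; have [sQ sQb] := symQ (ltnW kN).
  have [sR sRb] := symR kN; have [pR pRb] := posR kN.
  have [sS sT pS pT] := riccati_sol_sym_psd symQ symR psdQ posR kN.
  have [w0 v0 w2 v2 wv] := noise kN.
  have mw := @measurable_funPT _ _ _ _ (w k).
  have mv := @measurable_funPT _ _ _ _ (v k).
  have := costate_step (@info_sub k) mw mv w0 v0 w2 v2 wv sQ sQb sR sRb pR pRb
    sS sT pS pT (adapted_opt (ltnW kN)) (adapted_state_y (ltnW kN))
    (adapted_dx (ltnW kN)) (adapted_du kN).
  rewrite -dx_step// -opt_u_law -riccati_sol_step//.
  rewrite -/(pairing k) -/(tracking_error opt_u k).
  have -> : ip P (costate P (riccati_sol c N k.+1)
      (step_x P c k (w k) (state_x P c zx w opt_u k) (opt_u k))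
      (step_y P c k (v k) (state_y P c zy v k))) (dx k.+1) = pairing k.+1 by [].
  move=> ->; ring.
rewrite (eq_bigr (fun k : 'I_N => pairing k - pairing k.+1))//.
have -> : \sum_(k < N) (pairing k - pairing k.+1) = pairing 0 - pairing N.
  rewrite -(big_mkord xpredT (fun k => pairing k - pairing k.+1)).
  rewrite (eq_bigr (fun k => - (pairing k.+1 - pairing k))).
    by rewrite sumrN telescope_sumr// opprB.
  by move=> k _; rewrite opprB.
(* Both trajectories start from [zx], so the state perturbation vanishes at time 0. *)
have -> : pairing 0 = 0.
  have d0 : dx 0 = fun=> 0 by apply/funext => t; rewrite /dx /= subrr.
  rewrite /pairing d0 ipC -[RHS](mean_cst P); congr mean.
  by apply/funext => t; rewrite dot0l.
have [_ xL] := adapted_opt (leqnn N); have [_ yL] := adapted_state_y (leqnn N).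
have [_ dL] := adapted_dx (leqnn N); have [sQ sQb] := symQ (leqnn N).
rewrite sub0r addrC; apply/eqP; rewrite subr_eq0; apply/eqP.
have eL := L2_tracking_error adapted_opt_u (leqnn N).
(* The terminal cross matrices are the negatives of the terminal weights, so the costate at [N]
   applies these weights to the tracking error and the last pairing is exactly the terminal term. *)
rewrite bil_centered// /pairing riccati_sol_end.
have cx := L2_centered xL; have cy := L2_centered yL.
have dE : dx N = fun t => centered P (dx N) t + Evec P (dx N).
  by apply/funext => t; rewrite subrK.
rewrite [X in _ = ip P _ X]dE [in RHS]/costate.
rewrite ip_addcst ?Evec_centered//; last first.
  by rewrite EvecD ?Evec_mulmx ?Evec_centered// ?mulmx0 ?addr0//; exact: L2mx.
- exact: L2_centered.
- by apply: L2D; exact: L2mx.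
rewrite (EvecB xL yL) /=; congr (_ + _).
  congr ip; apply/funext => t; rewrite tr_mxN sQ /centered /tracking_error.
  rewrite (EvecB xL yL) mulNmx -mulmxBr; congr (_ *m _).
  by apply/dot_inj => z; rewrite !(dotDr, dotNr); ring.
by rewrite tr_mxB tr_mxN sQ sQb -opprD mulNmx -mulmxBr.
Qed.

Lemma real_costD : real_cost u = real_cost opt_u +
  (\sum_(k < N) (bil P (Q_ c k) (Qb_ c k) (dx k) (dx k)
                 + bil P (R_ c k) (Rb_ c k) (du k) (du k))
   + bil P (Q_ c N) (Qb_ c N) (dx N) (dx N)).
Proof.
have eE k : tracking_error u k = fun t => tracking_error opt_u k t + dx k t.
  apply/funext => t; rewrite /tracking_error /dx.
  by apply/dot_inj => z; rewrite !(dotDr, dotNr); ring.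
have uE k : u k = fun t => opt_u k t + du k t.
  by apply/funext => t; rewrite /du addrC subrK.
have D k : (k <= N)%N ->
    bil P (Q_ c k) (Qb_ c k) (tracking_error u k) (tracking_error u k) =
    bil P (Q_ c k) (Qb_ c k) (tracking_error opt_u k) (tracking_error opt_u k)
    + 2 * bil P (Q_ c k) (Qb_ c k) (tracking_error opt_u k) (dx k)
    + bil P (Q_ c k) (Qb_ c k) (dx k) (dx k).
  move=> kN; have [sQ sQb] := symQ kN; rewrite eE bil_sqrD//.
    exact: L2_tracking_error adapted_opt_u kN.
  by have [] := adapted_dx kN.
have D' k : (k < N)%N -> bil P (R_ c k) (Rb_ c k) (u k) (u k) =
    bil P (R_ c k) (Rb_ c k) (opt_u k) (opt_u k)
    + 2 * bil P (R_ c k) (Rb_ c k) (opt_u k) (du k)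
    + bil P (R_ c k) (Rb_ c k) (du k) (du k).
  move=> kN; have [sR sRb] := symR kN; rewrite {1 2}uE bil_sqrD//.
    exact: L2opt.
  by have [] := adapted_du kN.
rewrite /real_cost D// (eq_bigr (fun k : 'I_N =>
    (bil P (Q_ c k) (Qb_ c k) (tracking_error opt_u k) (tracking_error opt_u k)
     + bil P (R_ c k) (Rb_ c k) (opt_u k) (opt_u k))
    + 2 * (bil P (Q_ c k) (Qb_ c k) (tracking_error opt_u k) (dx k)
     + bil P (R_ c k) (Rb_ c k) (opt_u k) (du k))
    + (bil P (Q_ c k) (Qb_ c k) (dx k) (dx k)
     + bil P (R_ c k) (Rb_ c k) (du k) (du k)))); last first.
  move=> k _; have kN := ltn_ord k.
  by rewrite (D _ (ltnW kN)) (D' _ kN); ring.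
rewrite 2!big_split/= -mulr_sumr.
by have := first_variation; lra.
Qed.

Lemma bil_dx_ge0 k : (k <= N)%N -> 0 <= bil P (Q_ c k) (Qb_ c k) (dx k) (dx k).
Proof.
move=> kN; have [pQ pQb] := psdQ kN; apply: bil_ge0 => //.
by have [] := adapted_dx kN.
Qed.

Lemma bil_du_ge0 k : (k < N)%N -> 0 <= bil P (R_ c k) (Rb_ c k) (du k) (du k).
Proof.
move=> kN; have [pR pRb] := posR kN.
apply: bil_ge0; [exact: posdef_psd|exact: posdef_psd|].
by have [] := adapted_du kN.
Qed.

Lemma opt_u_min : real_cost opt_u <= real_cost u.
Proof.
rewrite real_costD lerDl addr_ge0 ?bil_dx_ge0// sumr_ge0// => k _.
by rewrite addr_ge0 ?bil_dx_ge0 ?bil_du_ge0// ltnW.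
Qed.

(** The excess cost is a sum of nonnegative terms, so each vanishes; only the control weights are
    definite, hence equality is read off from the control terms. *)
Lemma opt_u_unique : real_cost u <= real_cost opt_u ->
  forall k, (k < N)%N -> {ae P, forall t, u k t = opt_u k t}.
Proof.
move=> uopt k kN; have [pR pRb] := posR kN.
have B0 : bil P (R_ c k) (Rb_ c k) (du k) (du k) = 0.
  apply/eqP; rewrite eq_le bil_du_ge0// andbT.
  move: uopt; rewrite real_costD (bigD1 (Ordinal kN))//=.
  have := bil_dx_ge0 (ltnW kN); have := bil_dx_ge0 (leqnn N).
  have : 0 <= \sum_(i < N | i != Ordinal kN)
      (bil P (Q_ c i) (Qb_ c i) (dx i) (dx i) +
       bil P (R_ c i) (Rb_ c i) (du i) (du i)).
    by apply: sumr_ge0 => i _; rewrite addr_ge0 ?bil_dx_ge0 ?bil_du_ge0// ltnW.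
  lra.
have [_ duL] := adapted_du kN.
have := bil_eq0 pR pRb duL B0.
by apply: filterS => t /eqP; rewrite subr_eq0 => /eqP.
Qed.

End Perturbation.

Lemma opt_u_unique_minimizer : unique_minimizer P N c zx zy w v opt_u.
Proof.
have optA := adapted_opt_u.
split=> [|u' /admissibleP u'A|u' /admissibleP u'A u'min k kN].
- exact/admissibleP.
- by rewrite !cost_real// lee_fin; exact: opt_u_min.
- apply: opt_u_unique => //.
  have /u'min := (admissibleP opt_u).2 optA.
  by rewrite !cost_real// lee_fin.
Qed.

End Filtration.

Theorem theorem4p2 (R : realType) (d : measure_display) (T : measurableType d)
    (P : probability T R) (n m N : nat) (c : lq_coeffs R n m)
    (zx zy : T -> 'cV[R]_n) (w v : nat -> {RV P >-> R})
    (N_gt0 : (0 < N)%N)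
    (symQ : forall k, (k <= N)%N ->
       symmetric_mx (Q_ c k) /\ symmetric_mx (Qb_ c k))
    (symR : forall k, (k < N)%N ->
       symmetric_mx (R_ c k) /\ symmetric_mx (Rb_ c k))
    (zx2 : square_integrable P zx) (zy2 : square_integrable P zy)
    (noise : forall k, (k < N)%N ->
       let Fk := info zx zy w v k in
       [/\ cond_expectation P Fk (w k) (fun=> 0),
           cond_expectation P Fk (v k) (fun=> 0),
           cond_expectation P Fk (fun t => w k t ^+ 2) (fun=> 1),
           cond_expectation P Fk (fun t => v k t ^+ 2) (fun=> 1) &
           cond_expectation P Fk (fun t => w k t * v k t) (fun=> rho_ c)])
    (psdQ : forall k, (k <= N)%N ->
       psd (Q_ c k) /\ psd (Q_ c k + Qb_ c k))
    (posR : forall k, (k < N)%N ->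
       posdef (R_ c k) /\ posdef (R_ c k + Rb_ c k)) :
  (forall k, (k < N)%N ->
     W1 c k (riccati_sol c N k.+1) \in unitmx /\
     W2 c k (riccati_sol c N k.+1) \in unitmx) /\
  exists u : nat -> T -> 'cV[R]_m,
    feedback_control P N c zx zy w v u /\
    unique_minimizer P N c zx zy w v u.
Proof.
split; first exact: riccati_sol_unit symQ symR psdQ posR.
exists (opt_u N c zx zy w v); split; first exact: opt_u_feedback.
exact: opt_u_unique_minimizer.
Qed.
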